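(* Let $K$ be a totally real number field of degree $n$ with ring of integers $\mathcal{O}$, and let $\Gamma=\mathrm{SL}_2(\mathcal{O})$. There is a constant $c$, independent of the ideal $I$, such that for any sequence of nonzero ideals $I$ of $\mathcal{O}$ with $\mathrm{N}(I)\to\infty$, all but finitely many members $I$ of the sequence satisfy $$\mathrm{sys}\,\pi_1(M_I)\ \ge\ \frac{4}{3\sqrt{n}}\log\big([\Gamma:\Gamma(I)]\big)-c,$$ where $\Gamma(I)$ is the principal congruence subgroup of $\Gamma$ associated to $I$ and $M_I=(\mathbb{H}^2)^n/\Gamma(I)$.
   Context: $\mathbb{H}^2$ is the hyperbolic plane (upper half-plane model, curvature $-1$), on which $\mathrm{SL}_2(\mathbb{R})$ acts by fractional linear transformations. $(\mathbb{H}^2)^n$ carries the product Riemannian metric, so its distance is $d(z,w)=\big(\sum_{i=1}^n d_{\mathbb{H}^2}(z_i,w_i)^2\big)^{1/2}$, and $(\mathrm{SL}_2(\mathbb{R}))^n$ acts on it factor by factor. Let $\sigma_1,\dots,\sigma_n:K\to\mathbb{R}$ be the $n$ real embeddings of $K$. The group $\Gamma=\mathrm{SL}_2(\mathcal{O})$ acts on $(\mathbb{H}^2)^n$ via $A\mapsto(\sigma_1(A),\dots,\sigma_n(A))$, where $\sigma_i(A)$ is obtained by applying $\sigma_i$ to the entries of $A$. For a nonzero ideal $I\subset\mathcal{O}$, $\mathrm{N}(I)=|\mathcal{O}/I|$ and $\Gamma(I)=\ker\big(\mathrm{SL}_2(\mathcal{O})\to\mathrm{SL}_2(\mathcal{O}/I)\big)$,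 a finite-index normal subgroup of $\Gamma$. When $\Gamma(I)$ acts freely on $(\mathbb{H}^2)^n$ (which is the case when $\mathrm{N}(I)$ is sufficiently large), $M_I=(\mathbb{H}^2)^n/\Gamma(I)$ is a Riemannian manifold with the metric induced from $(\mathbb{H}^2)^n$. The systole $\mathrm{sys}\,\pi_1(M)$ of a Riemannian manifold $M$ is the least length of a non-contractible closed geodesic in $M$. *)

(* Defs.v *)
From HB Require Import structures.
From mathcomp Require Import all_boot all_order all_algebra all_field.
From mathcomp Require Import finmap complex generic_quotient.
From mathcomp Require Import all_classical all_reals all_analysis.
From mathcomp Require Import ring.

Set Implicit Arguments.
Unset Strict Implicit.
Unset Printing Implicit Defensive.

Import Order.TTheory GRing.Theory Num.Theory.
Import numFieldNormedType.Exports.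

Local Open Scope classical_set_scope.
Local Open Scope ring_scope.
Local Open Scope complex_scope.
Local Open Scope quotient_scope.

(* Number of elements of a finite set; infinite sets get the value 0. *)
Definition finite_card (T : choiceType) (A : set T) : nat := size (fset_set A).

Section NumberField.
Variable K : fieldExtType rat.

Definition algebraic_integer : {pred K} :=
  fun x => `[< integralOver (intr : int -> K) x >].

Fact algebraic_integer_subring : subring_closed algebraic_integer.
Proof.
split=> [|x y /asboolP xI /asboolP yI|x y /asboolP xI /asboolP yI].
- by apply/asboolP; exact: (@integral1 int K intr).
- by apply/asboolP; exact: (@integral_sub int K intr).
- by apply/asboolP; exact: (@integral_mul int K intr).
Qed.

HB.instance Definition _ :=
  GRing.isSubringClosed.Build K algebraic_integer algebraic_integer_subring.

Record integers := Integers {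
  integers_val :> K;
  integers_valP : integers_val \in algebraic_integer }.

HB.instance Definition _ := [isSub for integers_val].
HB.instance Definition _ := [Choice of integers by <:].
HB.instance Definition _ := [SubChoice_isSubComNzRing of integers by <:].

(* Unlike the library's [idealr_closed], this allows the unit ideal. *)
Definition is_ideal (I : set integers) : Prop :=
  [/\ I 0, forall x y, I x -> I y -> I (x + y) & forall a x, I x -> I (a * x)].

Definition nonzero_ideal (I : set integers) : Prop :=
  is_ideal I /\ exists2 x, I x & x != 0.

Definition ideal_norm (I : set integers) : nat :=
  finite_card [set [set x + y | y in I] | x in [set: integers]].

End NumberField.

Definition SL2 (A : comNzRingType) : set 'M[A]_2 := [set g | \det g = 1].

(* The kernel of the reduction SL_2(O) -> SL_2(O/I). *)
Definition congruence_subgroup (K : fieldExtType rat) (I : set (integers K)) :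
    set 'M[integers K]_2 :=
  [set g | SL2 g /\ forall i j, I ((g - 1%:M) i j)].

Definition group_index (A : comNzRingType) (G H : set 'M[A]_2) : nat :=
  finite_card [set [set g *m h | h in H] | g in G].

Definition totally_real (R : realType) (K : fieldExtType rat) : Prop :=
  forall (f : {rmorphism K -> R[i]}) (x : K), complex.Im (f x) = 0.

Definition real_embeddings (R : realType) (K : fieldExtType rat) (n : nat)
    (sigma : 'I_n -> {rmorphism K -> R}) : Prop :=
  (forall i j, sigma i =1 sigma j -> i = j) /\
  (forall f : {rmorphism K -> R}, exists i, f =1 sigma i).

Section Hyperbolic.
Variable R : realType.

Definition half_plane : set (R[i])^o := [set z | 0 < complex.Im z].

Definition arcosh (x : R) : R := ln (x + Num.sqrt (x ^+ 2 - 1)).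

Definition sqmod (z : R[i]) : R := complex.Re z ^+ 2 + complex.Im z ^+ 2.

Definition dist_H2 (z w : half_plane) : R :=
  arcosh (1 + sqmod (\val z - \val w)
              / (2 * complex.Im (\val z) * complex.Im (\val w))).

Definition frac_lin (g : 'M[R]_2) (z : R[i]) : R[i] :=
  ((g 0 0)%:C * z + (g 0 1)%:C) / ((g 1 0)%:C * z + (g 1 1)%:C).

(* The default value [z] of [insubd] is never used when [g] is in SL_2(R):
   see [val_mobius]. *)
Definition mobius (g : 'M[R]_2) (z : half_plane) : half_plane :=
  insubd z (frac_lin g (\val z)).

Lemma val_mobius (g : 'M[R]_2) (z : half_plane) :
  SL2 g -> \val (mobius g z) = frac_lin g (\val z).
Proof.
rewrite /SL2 /= => dg.
have {}dg : g 0 0 * g 1 1 - g 0 1 * g 1 0 = 1.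
  have e (k : 'I_1) : lift 0 k = 1 :> 'I_2 by apply/val_inj; rewrite (ord1 k).
  have e' (k : 'I_1) : lift 1 k = 0 :> 'I_2 by apply/val_inj; rewrite (ord1 k).
  rewrite -dg (expand_det_row _ 0) !big_ord_recl big_ord0 /cofactor.
  rewrite !det_mx11 !mxE !e !e' /= addr0 expr0 mul1r.
  by rewrite expr1 mulN1r mulrN.
rewrite /mobius insubdK // inE /half_plane /= /frac_lin.
case: z => -[x y] /= /set_mem; rewrite /half_plane /= => y0.
set a := g 0 0 in dg *; set b := g 0 1 in dg *.
set c := g 1 0 in dg *; set d := g 1 1 in dg *.
rewrite /= !mul0r !subr0 !addr0.
set D := (c * x + d) ^+ 2 + (c * y) ^+ 2.
have D0 : D != 0.
  rewrite /D paddr_eq0 ?sqr_ge0 // !sqrf_eq0 mulf_eq0 (gt_eqF y0) orbF.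
  apply/negP => /andP[/eqP e1 /eqP c0]; move: e1; rewrite c0 mul0r add0r => d0.
  by move: dg; rewrite c0 d0 !mulr0 subr0 => /esym/eqP; rewrite oner_eq0.
have -> : (a * x + b) * - (c * y / D) + a * y * ((c * x + d) / D)
    = (a * d - b * c) * y / D by ring.
by rewrite dg mul1r divr_gt0 // lt0r D0 addr_ge0 // sqr_ge0.
Qed.

Definition H2n (n : nat) : Type := prod_topology (fun _ : 'I_n => half_plane).
HB.instance Definition _ n := Topological.on (H2n n).

Definition dist_H2n (n : nat) (z w : H2n n) : R :=
  Num.sqrt (\sum_(i < n) dist_H2 (z i) (w i) ^+ 2).

End Hyperbolic.

Section Quotient.
Variables (R : realType) (K : fieldExtType rat) (n : nat).
Variable sigma : 'I_n -> {rmorphism K -> R}.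

Definition act (g : 'M[integers K]_2) (z : H2n R n) : H2n R n :=
  fun i => mobius (map_mx (sigma i \o \val) g) (z i).

Variable I : set (integers K).

Definition orbit (z : H2n R n) : set (H2n R n) :=
  [set act g z | g in congruence_subgroup I].

Definition same_orbit : rel (H2n R n) := fun z w => `[< orbit z = orbit w >].

Fact same_orbit_equiv : equiv_class_of same_orbit.
Proof.
split=> [z|z w|w z t].
- exact/asboolP.
- by apply/asboolP/asboolP.
- by move=> /asboolP zw /asboolP wt; apply/asboolP; rewrite zw.
Qed.

Canonical same_orbit_equiv_rel := EquivRelPack same_orbit_equiv.

Definition quot_space : Type :=
  quotient_topology {eq_quot same_orbit_equiv_rel}.
HB.instance Definition _ := Topological.on quot_space.

Definition quot_proj (z : H2n R n) : quot_space :=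
  (\pi_(quotient_topology {eq_quot same_orbit_equiv_rel}) z)%qT.

(* The distance of the induced Riemannian metric: since the group acts by
   isometries and the projection is a Riemannian covering, it is the infimum of
   the distances between representatives. *)
Definition quot_dist (a b : quot_space) : R :=
  inf [set r | exists z w,
         [/\ quot_proj z = a, quot_proj w = b & r = dist_H2n z w]].

End Quotient.

Section Systole.
Variables (R : realType) (T : topologicalType) (d : T -> T -> R).

(* [c] is a closed geodesic of length [L]: an [L]-periodic curve parametrized by
   arc length and locally distance minimizing (for the Riemannian distance these
   are exactly the unit speed solutions of the geodesic equation). *)
Definition closed_geodesic (c : R -> T) (L : R) : Prop :=
  [/\ 0 < L,
      forall t, c (t + L) = c t &
      forall t, exists2 e, 0 < e &
        forall s u, `|s - t| < e -> `|u - t| < e -> d (c s) (c u) = `|s - u|].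

(* Free homotopy through loops, from the restriction of [c] to [0, L] to a
   constant loop. *)
Definition contractible_loop (c : R -> T) (L : R) : Prop :=
  exists (h : R * R -> T) (p : T),
    [/\ {within `[0, 1] `*` `[0, L], continuous h},
        forall t, t \in `[0, L] -> h (0, t) = c t,
        forall t, t \in `[0, L] -> h (1, t) = p &
        forall s, s \in `[0, 1] -> h (s, 0) = h (s, L)].

Definition systole : \bar R :=
  ereal_inf [set L%:E | L in
    [set L | exists2 c, closed_geodesic c L & ~ contractible_loop c L]].

End Systole.

(* Main.v *)
Require Import Defs.
From mathcomp Require Import all_boot all_order all_algebra all_field.
From mathcomp Require Import finmap complex generic_quotient.
From mathcomp Require Import all_classical all_reals all_analysis.
From mathcomp Require Import ring lra zify.

Import Order.TTheory GRing.Theory Num.Theory.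
Import numFieldNormedType.Exports.

Local Open Scope classical_set_scope.
Local Open Scope ring_scope.

(** A closed geodesic of the quotient lifts to a curve [f] of the product of
    hyperbolic planes with [f (t + L) = g (f t)] for some [g] in the congruence
    subgroup of [I], so its length [L] is at least the displacement of [g] at
    [f 0].  Everything depends on the trace of [g].

    If [\tr g != 2]: since [\det g = 1], the integer [\tr g - 2] is minus the
    determinant of [g - 1], whose entries are in [I].  It is thus a nonzero
    element of the square of [I], and the absolute value of its norm is at least
    a constant times [N(I) ^ 2] ([embnorm_det_ideal]).  In each factor,
    displacement and trace are related by [(t - 2) ^ 2 <= 16 * exp d]
    ([trace_displacement]), so the displacements [d_i] of the components have a
    sum at least [4 * ln N(I)] up to a constant ([total_displacement]), and the
    Cauchy-Schwarz inequality bounds [sqrt n * L] from below by this sum.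
    Finally the index of the subgroup is at most [N(I) ^ 3]
    ([group_index_le]).

    If [\tr g = 2] and [g] is not the identity, then [g] is parabolic at every
    place.  Moving its fixed point to infinity, [g] becomes a horizontal
    translation of one factor.  The height of the corresponding component of
    [f] is then periodic, hence has a minimum, but the height at the midpoint
    of a geodesic segment is more than the geometric mean of the heights of its
    ends unless the segment is vertical.  This forces the component to be
    constant, which contradicts the translation ([no_parabolic_axis]).

    If [g] is the identity, the lift is a closed curve and the original curve is
    contractible ([contractible_of_closed_lift]).

    The bound [N(I) ^ 2] up to a constant avoids the factorization theory of
    ideals.  By the pigeonhole argument with which Hurwitz proves the finiteness
    of the class number, some multiple [m * I] is contained in a principal ideal
    [x * O] with [x] in [I] and [m] independent of [I]
    ([ideal_nearly_principal]), and [N(I)] is at most a constant times the norm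
    of [x] ([ideal_norm_le_embnorm]).  Hence the elements of the square of [I]
    are, up to a bounded factor, multiples of [x ^ 2].

    Lifting requires that the orbits be discrete.  The displacement of the
    elements of trace different from 2 is uniformly bounded below once [N(I)]
    is large, and that of the other elements is bounded below at each point
    because a nonzero integer has a conjugate of absolute value at least 1
    ([displacement_bounded_below]). *)

Set Implicit Arguments.
Unset Strict Implicit.
Unset Printing Implicit Defensive.

(** * Embeddings of a number field and the norm of an integer *)

(** Dedekind's argument: from a relation with [c j != 0], subtracting
    [sigma j x] times the relation from its translate by [x] gives a relation
    with smaller support. *)
Lemma embeddings_independent (R : fieldType) (K : fieldType) (n : nat)
    (sigma : 'I_n -> {rmorphism K -> R})
    (sigma_inj : forall i j, sigma i =1 sigma j -> i = j) (c : 'I_n -> R) :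
  (forall x, \sum_i c i * sigma i x = 0) -> forall i, c i = 0.
Proof.
have [m] := ubnP #|[pred i | c i != 0]|.
elim: m c => // m IHm c lem c0 j; have [//|cj0] := eqVneq (c j) 0.
have ck k : k != j -> c k = 0.
  move=> kj; apply/eqP/negPn/negP => ck0; move/eqP: kj; apply.
  apply: sigma_inj => x.
  suff /(_ k)/eqP : forall i, c i * (sigma i x - sigma j x) = 0.
    by rewrite mulf_eq0 (negbTE ck0) /= subr_eq0 => /eqP.
  apply: IHm => [|y].
    apply: (leq_trans _ (lem : (_ <= m)%N)); apply: proper_card; apply/properP; split.
      apply/fintype.subsetP => i; rewrite !inE; apply: contra => /eqP ->.
      by rewrite mul0r.
    by exists j; rewrite !inE ?subrr ?mulr0 ?eqxx //=.
  transitivity (\sum_i c i * sigma i (x * y) - sigma j x * \sum_i c i * sigma i y).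
    rewrite mulr_sumr -sumrB; apply: eq_bigr => i _; rewrite rmorphM; ring.
  by rewrite !c0 mulr0 subr0.
have := c0 1; rewrite (bigD1 j) //= big1 ?addr0 ?rmorph1 ?mulr1 // => i ij.
by rewrite ck // mul0r.
Qed.

(** If [p] has degree [d] and leading coefficient [a], then [a * x] is a root of
    the monic polynomial [a ^ (d - 1) * p (X / a)]. *)
Lemma integral_lead_coef_mul (L : comNzRingType) (p : {poly int}) (x : L) :
  root (map_poly intr p) x -> integralOver (intr : int -> L) ((lead_coef p)%:~R * x).
Proof.
have [->|p0] := eqVneq p 0.
  by rewrite lead_coef0 mul0r => _; exact: mxpoly.integral0.
set a := lead_coef p => /eqP.
have := p0; rewrite -size_poly_gt0.
case E : (size p) => [//|d] _.
have horner_int (r : {poly int}) m (y : L) : (size r <= m)%N ->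
    (map_poly intr r).[y] = \sum_(i < m) (r`_i)%:~R * y ^+ i.
  move=> rm; rewrite (@horner_coef_wide _ m) ?(leq_trans (size_poly _ _)) //.
  by apply: eq_bigr => i _; rewrite coef_map.
rewrite (horner_int _ d.+1) ?E // big_ord_recr /=.
have -> : p`_d = a by rewrite /a lead_coefE E.
case: d E => [|d] E.
  by rewrite big_ord0 add0r mulr1 => ->; rewrite mul0r; exact: mxpoly.integral0.
move=> px.
pose r : {poly int} := \poly_(i < d.+1) (p`_i * a ^+ (d - i)).
have size_r : (size r < size ('X^(d.+1) : {poly int}))%N.
  by rewrite size_polyXn ltnS size_poly.
exists ('X^(d.+1) + r); first by rewrite monicE lead_coefDl // lead_coefXn.
rewrite rootE rmorphD /= map_polyXn hornerD hornerXn (horner_int _ d.+1) ?size_poly //.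
apply/eqP.
transitivity (a%:~R ^+ d * (\sum_(i < d.+1) (p`_i)%:~R * x ^+ i + a%:~R * x ^+ d.+1));
  last by rewrite px mulr0.
rewrite mulrDr [LHS]addrC; congr (_ + _).
  rewrite mulr_sumr; apply: eq_bigr => i _.
  rewrite coef_poly ltn_ord exprMn rmorphM rmorphXn /=.
  have -> : (a%:~R : L) ^+ d = a%:~R ^+ (d - i) * a%:~R ^+ i.
    by rewrite -exprD subnK // -ltnS.
  by ring.
by rewrite exprMn exprS; ring.
Qed.

Lemma integral_multiple (K : fieldExtType rat) (x : K) :
  exists2 m : nat, (0 < m)%N & m%:R * x \in @algebraic_integer K.
Proof.
have /polyOver1P [p pE] := minPolyOver 1%AS x.
have [q [a a0 qE]] := rat_poly_scale p.
have q0 : q != 0.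
  apply: contraTneq (monic_neq0 (monic_minPoly 1%AS x)) => q0.
  by rewrite pE qE q0 !rmorph0 scaler0 rmorph0 eqxx.
have qx : root (map_poly intr q) x.
  have := root_minPoly 1%AS x; rewrite pE qE map_polyZ /= /root hornerZ.
  rewrite mulf_eq0 scaler_eq0 oner_eq0 orbF invr_eq0 intr_eq0 (negbTE a0) /=.
  rewrite -map_poly_comp.
  suff -> : in_alg K \o intr = intr by [].
  by apply/funext => z /=; rewrite alg_num_field ratr_int.
exists `|lead_coef q|%N; first by rewrite absz_gt0 lead_coef_eq0.
apply/asboolP; have := integral_lead_coef_mul qx.
set z := lead_coef q; rewrite -[in X in X -> _](mulr_sign_norm z).
set s := (-1) ^+ _ => zI; have := integral_mul (integral_id intr s) zI.
rewrite mulrA -intrM mulrA -expr2 sqrr_sign mul1r.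
by rewrite -abszE.
Qed.

Section Norm.
Variables (R : realType) (K : fieldExtType rat) (n : nat).
Variable sigma : 'I_n -> {rmorphism K -> R}.
Hypothesis hn : \dim {:K} = n.
Hypothesis sigma_inj : forall i j, sigma i =1 sigma j -> i = j.

(** The conjugates of [x] are the eigenvalues of the multiplication by [x],
    whose matrix over the rationals is conjugate to their diagonal matrix by the
    matrix [V] of the embeddings of a basis. *)
Lemma prod_embeddings_rational (x : K) :
  exists q : rat, \prod_i sigma i x = ratr q.
Proof.
case: n / hn sigma sigma_inj => s s_inj.
pose b := vbasis {:K}.
have bE v i : s i v = \sum_k ratr (coord b k v) * s i b`_k.
  rewrite {1}(coord_vbasis (memvf v)) rmorph_sum; apply: eq_bigr => k _.
  by rewrite rmorphZ_num.
pose V : 'M[R]_(\dim {:K}) := \matrix_(j, i) s i b`_j.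
pose M : 'M[rat]_(\dim {:K}) := \matrix_(j, k) coord b k (x * b`_j).
have MV : map_mx ratr M *m V = V *m diag_mx (\row_i s i x).
  apply/matrixP => j i; rewrite mul_mx_diag !mxE.
  under eq_bigr do rewrite !mxE.
  by rewrite -bE rmorphM mulrC.
have V0 : \det V != 0.
  rewrite -det_tr; apply/det0P => -[v v0 vV].
  move/negP: v0; apply; apply/eqP/rowP => i; rewrite mxE.
  apply: (embeddings_independent s_inj (c := fun i => v 0 i)) => {x M MV}x.
  transitivity (\sum_k ratr (coord b k x) * (v *m V^T) 0 k); last first.
    by apply: big1 => k _; rewrite vV mxE mulr0.
  under eq_bigr do rewrite bE mulr_sumr.
  rewrite exchange_big; apply: eq_bigr => k _ /=.
  rewrite mxE mulr_sumr; apply: eq_bigr => l _; rewrite !mxE; ring.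
exists (\det M); move/(congr1 determinant): MV.
rewrite !det_mulmx det_map_mx det_diag mulrC => /(mulfI V0) ->.
by apply: eq_bigr => i _; rewrite mxE.
Qed.

(** The rational root theorem, transported from algebraic numbers. *)
Lemma integral_rat_int (q : rat) :
  integralOver (intr : int -> R) (ratr q) -> q \is a Num.int.
Proof.
case=> p pm /eqP.
have -> : map_poly intr p = map_poly ratr (map_poly intr p : {poly rat}) :> {poly R}.
  by rewrite -map_poly_comp; apply: eq_map_poly => z /=; rewrite ratr_int.
rewrite horner_map => /eqP; rewrite fmorph_eq0 => /eqP pq.
have : (ratr q : algC) \in Aint.
  apply: (@root_monic_Aint (map_poly ratr (map_poly intr p : {poly rat}))).
  - by rewrite rootE horner_map pq rmorph0.
  - by rewrite map_monic; exact: monic_map pm.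
  - apply/polyOverP => i; rewrite !coef_map /= ratr_int; exact: intr_int.
move/(Cint_rat_Aint (Crat_rat q)).
move=> /intrP [z]; rewrite -(ratr_int algC) => /fmorph_inj ->.
exact: intr_int.
Qed.

(** The absolute value of the field norm of [x]. *)
Definition embnorm (x : K) : R := \prod_i `|sigma i x|.

Lemma embnormM x y : embnorm (x * y) = embnorm x * embnorm y.
Proof.
by rewrite /embnorm -big_split; apply: eq_bigr => i _; rewrite rmorphM normrM.
Qed.

Lemma embnorm_ge0 x : 0 <= embnorm x. Proof. exact: prodr_ge0. Qed.

Lemma embnorm_gt0 x : x != 0 -> 0 < embnorm x.
Proof. by move=> x0; apply: prodr_gt0 => i _; rewrite normr_gt0 fmorph_eq0. Qed.

(** The product of the conjugates is rational and integral over the integers,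
    hence an integer. *)
Lemma embnorm_nat (x : integers K) : exists m : nat, embnorm (\val x) = m%:R.
Proof.
have [q qE] := prod_embeddings_rational (\val x).
have : q \is a Num.int.
  apply: integral_rat_int; rewrite -qE.
  apply: (big_ind (integralOver (intr : int -> R))).
  - exact: integral1.
  - exact: integral_mul.
  move=> i _; have /asboolP xI := integers_valP x.
  have := @integral_rmorph _ _ _ _ (sigma i) _ xI.
  suff -> : sigma i \o intr = intr by [].
  by apply/funext => z /=; rewrite rmorph_int.
case/intrP => z zE; exists `|z|%N.
by rewrite /embnorm -normr_prod qE zE ratr_int -intr_norm pmulrn abszE.
Qed.

Lemma embnorm_ge1 (x : integers K) : x != 0 -> 1 <= embnorm (\val x).
Proof.
move=> x0; have [m mE] := embnorm_nat x.
have : 0 < embnorm (\val x) by apply: embnorm_gt0; apply: contraNneq x0 => x0;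
  apply/eqP/val_inj.
by rewrite mE ler1n ltr0n.
Qed.

Lemma embnorm_lt1 (x : integers K) : embnorm (\val x) < 1 -> x = 0.
Proof. by move=> x1; apply/eqP; apply: contraTT x1 => /embnorm_ge1; rewrite leNgt. Qed.

Lemma integral_basis : exists b : 'I_n -> integers K,
  forall x : K, exists q : 'I_n -> rat, x = \sum_j q j *: \val (b j).
Proof.
case: n / hn; pose v := vbasis {:K}.
have key j : exists mb : nat * integers K, (0 < mb.1)%N /\ \val mb.2 = mb.1%:R * v`_j.
  have [m m0 mI] := integral_multiple v`_j.
  by exists (m, Integers mI).
have [mb mbP] := choice (fun j : 'I_(\dim {:K}) => key j).
exists (fun j => (mb j).2) => x; exists (fun j => coord v j x / (mb j).1%:R).
rewrite {1}(coord_vbasis (memvf x)); apply: eq_bigr => j _.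
have [m0 ->] := mbP j.
rewrite mulr_natl -scaler_nat scalerA divfK //.
by rewrite pnatr_eq0 -lt0n.
Qed.
End Norm.

(** * Norms of ideals and of their elements *)

Lemma finite_card_le (T : choiceType) (F : finType) (A : set T) (f : T -> F) :
  (forall x y, A x -> A y -> f x = f y -> x = y) -> (finite_card A <= #|F|)%N.
Proof.
move=> f_inj; rewrite /finite_card /fset_set; case: pselect => // Afin.
case: cid => s /= sA; rewrite -(size_map f).
have : uniq [seq f x | x <- s].
  rewrite map_inj_in_uniq ?fset_uniq // => x y xs ys; apply: f_inj.
  - by rewrite sA.
  - by rewrite sA.
by move/card_uniqP => <-; exact: max_card.
Qed.

Lemma floor_eq_dist (F : archiRealDomainType) (u v : F) :
  Num.floor u = Num.floor v -> `|u - v| < 1.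
Proof.
move=> uv; have := floor_itv u; have := floor_itv v; rewrite uv intrD.
by move=> /andP[v1 v2] /andP[u1 u2]; rewrite ltr_norml; apply/andP; split; lra.
Qed.

Lemma floor_scale_lt (F : archiRealFieldType) (k : nat) (u : F) :
  0 <= u < 1 -> (0 < k)%N -> (`|Num.floor (u * k%:R)| < k)%N.
Proof.
move=> /andP[u0 u1] k0; rewrite -ltz_nat gez0_abs ?floor_ge0 ?mulr_ge0 //.
rewrite floor_lt_int.
by rewrite -[ltRHS]mul1r ltr_pM2r // ltr0n.
Qed.

Section IdealNorm.
Variables (R : realType) (K : fieldExtType rat) (n : nat).
Variable sigma : 'I_n -> {rmorphism K -> R}.
Hypothesis hn : \dim {:K} = n.
Hypothesis sigma_inj : forall i j, sigma i =1 sigma j -> i = j.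

Let n_gt0 : (0 < n)%N.
Proof. by rewrite -hn adim_gt0. Qed.

(** A norm comparison for coordinates in [b]; it is what makes both pigeonhole
    arguments below quantitative. *)
Lemma bounded_combinations (b : 'I_n -> integers K) : exists2 D : R, 0 < D &
  forall (r : 'I_n -> rat) (e : R) i, (forall j, `|ratr (r j)| <= e) ->
    `|sigma i (\sum_j r j *: \val (b j))| <= D * e.
Proof.
exists (1 + \sum_i \sum_j `|sigma i (\val (b j))|).
  by rewrite ltr_wpDr // sumr_ge0 // => i _; exact: sumr_ge0.
move=> r e i re; have e0 : 0 <= e.
  by rewrite (le_trans _ (re (Ordinal n_gt0))).
rewrite rmorph_sum; apply: le_trans (ler_norm_sum _ _ _) _.
apply: (@le_trans _ _ ((\sum_j `|sigma i (\val (b j))|) * e)).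
  rewrite mulr_suml; apply: ler_sum => j _.
  by rewrite rmorphZ_num normrM mulrC ler_wpM2l.
rewrite ler_wpM2r // ler_wpDl // [leRHS](bigD1 i) //= lerDl sumr_ge0 // => k _.
exact: sumr_ge0.
Qed.

Let zcomb (b : 'I_n -> integers K) (z : 'I_n -> int) : integers K :=
  \sum_j b j *~ z j.

Let val_zcomb b z : \val (zcomb b z) = \sum_j (z j)%:~R *: \val (b j).
Proof.
rewrite /zcomb rmorph_sum; apply: eq_bigr => j _.
by rewrite rmorphMz /= scaler_int.
Qed.

(** Round the coordinates of [x] in a basis of integers. *)
Lemma integers_cobounded : exists2 D : R, 0 < D &
  forall x : K, exists w : integers K, forall i, `|sigma i (x - \val w)| <= D.
Proof.
have [b bP] := integral_basis hn; have [D D0 DP] := bounded_combinations b.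
exists D => // x; have [q ->] := bP x.
exists (zcomb b (fun j => Num.floor (q j))) => i.
rewrite val_zcomb -sumrB -[leRHS]mulr1.
under eq_bigr do rewrite -scalerBl.
apply: DP => j; have /andP[q1 q2] := floor_itv (q j).
rewrite intrD in q2.
have q0 : 0 <= q j - (Num.floor (q j))%:~R by lra.
have : `|q j - (Num.floor (q j))%:~R| <= 1 by rewrite ger0_norm //; lra.
by rewrite -(ler_rat R) ratr_norm rmorph1.
Qed.

(** Pigeonhole on the fractional parts of the coordinates of the multiples
    [t * x], [0 <= t <= M]: two multiples lie in the same cell of the unit cube
    cut into [k ^ n] cells, and their difference is close to an integer. *)
Lemma hurwitz : exists2 M : nat, (0 < M)%N & forall x : K,
  exists t : nat, exists2 w : integers K,
    (0 < t <= M)%N & embnorm sigma (t%:R * x - \val w) < 1.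
Proof.
have [b bP] := integral_basis hn; have [D D0 DP] := bounded_combinations b.
pose k := (Num.truncn D).+1; have Dk : D < k%:R by exact: truncnS_gt.
have k0 : (0 : rat) < k%:R by rewrite ltr0n.
exists (k ^ n)%N => [|x]; first by rewrite expn_gt0.
have [q ->] := bP x.
pose fr (t : nat) j := q j *+ t - (Num.floor (q j *+ t))%:~R.
have fr01 t j : 0 <= fr t j < 1.
  have /andP[q1] := floor_itv (q j *+ t); rewrite intrD /fr => q2.
  by apply/andP; split; lra.
pose cell (t : 'I_(k ^ n).+1) : {ffun 'I_n -> 'I_k} :=
  [ffun j => Ordinal (floor_scale_lt (fr01 t j) (isT : (0 < k)%N))].
have : ~~ injectiveb cell.
  apply/negP => /injectiveP /leq_card.
  by rewrite card_ord card_ffun !card_ord ltnn.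
case/injectivePn => s [t st].
wlog lst : s t st / (s < t)%N.
  move=> H; have [lst|lst|/val_inj e] := ltngtP s t.
  - exact: H.
  - by rewrite eq_sym in st; move/esym; exact: H.
  - by rewrite e eqxx in st.
move=> cst; exists (t - s)%N.
exists (zcomb b (fun j => Num.floor (q j *+ t) - Num.floor (q j *+ s))).
  by rewrite subn_gt0 lst (leq_trans (leq_subr _ _)) // -ltnS.
rewrite val_zcomb mulr_sumr -sumrB.
have -> : \sum_j ((t - s)%:R * (q j *: \val (b j)) -
    (Num.floor (q j *+ t) - Num.floor (q j *+ s))%:~R *: \val (b j))
   = \sum_j (fr t j - fr s j) *: \val (b j).
  apply: eq_bigr => j _.
  rewrite mulr_natl -scaler_nat scalerA -scalerBl; congr (_ *: _).
  by rewrite /fr intrB natrB 1?ltnW // -(mulr_natl (q j) t) -(mulr_natl (q j) s); ring.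
have ni i : `|sigma i (\sum_j (fr t j - fr s j) *: \val (b j))| <= D / k%:R.
  apply: DP => j; have := congr1 (fun f : {ffun _ -> _} => f j) cst.
  rewrite /cell !ffunE => /(congr1 val) /= e.
  have {}e : Num.floor (fr s j * k%:R) = Num.floor (fr t j * k%:R).
    have f0 r : 0 <= Num.floor (fr r j * k%:R).
      by rewrite floor_ge0 mulr_ge0 //; case/andP: (fr01 r j).
    by rewrite -(gez0_abs (f0 s)) -(gez0_abs (f0 t)) e.
  have := floor_eq_dist (esym e); rewrite -mulrBl normrM (ger0_norm (ltW k0)).
  rewrite -ltr_pdivlMr // div1r => /ltW.
  by rewrite -(ler_rat R) ratr_norm fmorphV /= ratr_nat.
apply: (@le_lt_trans _ _ (\prod_(i < n) (D / k%:R))).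
  by apply: ler_prod => i _; rewrite normr_ge0 ni.
have Dk0 : 0 <= D / k%:R by rewrite divr_ge0 // ltW.
have Dk1 : D / k%:R < 1 by rewrite ltr_pdivrMr ?ltr0n // mul1r.
by rewrite prodr_const card_ord; case: (n) n_gt0 => // m _; exact: exprn_ilt1.
Qed.

Lemma coset_eq (I : set (integers K)) a y : is_ideal I ->
  [set a + u | u in I] y -> [set a + u | u in I] = [set y + u | u in I].
Proof.
case=> I0 ID IM [u Iu <-]; have IN v : I v -> I (- v) by rewrite -mulN1r; exact: IM.
apply/seteqP; split=> _ [v Iv <-].
- by exists (v - u); [apply: ID => //; exact: IN|ring].
- by exists (u + v); [exact: ID|ring].
Qed.

(** Every coset of [I] meets the box of the [y] with
    [`|sigma i y| <= D * `|sigma i x|].  Two elements of the box in the same cell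
    of a subdivision of each side in [q] parts differ by an integer of norm
    less than 1, hence are equal; so there are at most [q ^ n] cosets, where
    [q ^ n] has the order of magnitude of the norm of [x]. *)
Lemma ideal_norm_le_embnorm : exists2 C : R, 0 < C &
  forall (I : set (integers K)) (x : integers K), is_ideal I -> I x -> x != 0 ->
    (ideal_norm I)%:R <= C * embnorm sigma (\val x).
Proof.
have [D D0 DP] := integers_cobounded.
pose E := 2 * D + 1; have E0 : 0 < E by rewrite /E; lra.
exists ((2 * E) ^+ n) => [|I x Iid Ix x0]; first by rewrite exprn_gt0 ?mulr_gt0.
pose V := E ^+ n * embnorm sigma (\val x).
have V1 : 1 <= V.
  rewrite -[1]mul1r ler_pM //; last exact: embnorm_ge1 x0.
  by rewrite exprn_ege1 // /E; lra.
have : exists q : nat, V <= q%:R ^+ n.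
  exists (Num.truncn V).+1; apply: le_trans (ltW (truncnS_gt V)) _.
  by rewrite -natrX ler_nat -{1}[_.+1]expn1 leq_pexp2l.
(* By minimality [q ^+ n < V], so [q.+1 ^+ n <= 2 ^+ n * V]: no [n]-th root is
   needed. *)
move=> /ex_minnP [[|q] Vq qmin].
  by have := le_trans V1 Vq; rewrite expr0n -[n == 0]negbK -lt0n n_gt0 ler10.
have sx i : 0 < `|sigma i (\val x)|.
  by rewrite normr_gt0 fmorph_eq0; apply: contraNneq x0 => e; apply/eqP/val_inj.
pose small (P : set (integers K)) : set (integers K) := [set y | P y /\
  forall i, `|sigma i (\val y)| <= D * `|sigma i (\val x)|].
pose rep P := xget 0 (small P).
have repP P : [set [set a + u | u in I] | a in [set: integers K]] P ->
    small P (rep P).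
  move=> [a _ <-]; have [w wP] := DP (\val a / \val x).
  have xw : [set a + u | u in I] (a - x * w).
    by case: Iid => _ _ IM; exists (- w * x); [exact: IM|ring].
  suff : small [set a + u | u in I] (a - x * w) by move=> h;
    apply: (@xgetPex _ 0 (small _)); exists (a - x * w).
  split=> // i; rewrite -ler_pdivrMr // -normfV -normrM -fmorphV -rmorphM.
  have -> : \val (a - x * w) / \val x = \val a / \val x - \val w; last exact: wP.
  rewrite rmorphB rmorphM /= mulrBl [\val x * _]mulrC mulfK //.
pose v (y : integers K) i := (sigma i (\val y) / `|sigma i (\val x)| + D) / E.
pose cell P : {ffun 'I_n -> 'I_q.+1} :=
  [ffun i => inord `|Num.floor (v (rep P) i * q.+1%:R)|%N].
apply: (@le_trans _ _ (q.+1%:R ^+ n)).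
  rewrite -natrX ler_nat -[q.+1]card_ord -[n in (_ <= _ ^ n)%N]card_ord -card_ffun.
  apply: (finite_card_le (f := cell)) => P1 P2 cP1 cP2 cell12.
  have [P1r s1] := repP _ cP1; have [P2r s2] := repP _ cP2.
  have v01 y : (forall i, `|sigma i (\val y)| <= D * `|sigma i (\val x)|) ->
      forall i, 0 <= v y i < 1.
    move=> sy i; have := sy i; rewrite -ler_pdivrMr // -[X in _ / X]normr_id.
    rewrite -normfV -normrM ler_norml => /andP[h1 h2].
    by rewrite /v ler_pdivlMr // ltr_pdivrMr // /E; apply/andP; split; lra.
  suff e : rep P1 = rep P2.
    case: cP1 => a1 _ aP1; case: cP2 => a2 _ aP2.
    rewrite -aP1 in P1r *; rewrite -aP2 in P2r *.
    by rewrite (coset_eq Iid P1r) (coset_eq Iid P2r) aP1 aP2 e.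
  apply/eqP; rewrite -subr_eq0; apply/eqP; apply: (embnorm_lt1 hn sigma_inj).
  apply: lt_le_trans (_ : \prod_i (`|sigma i (\val x)| * (E / q.+1%:R)) <= 1).
    apply: ltr_prod; first by apply/hasP; exists (Ordinal n_gt0);
      rewrite ?mem_index_enum.
    move=> i _; rewrite normr_ge0 /=.
    have := congr1 (fun f : {ffun _ -> _} => f i) cell12.
    rewrite /cell !ffunE => /(congr1 val).
    rewrite /= !inordK ?(floor_scale_lt (v01 _ s1 i)) ?(floor_scale_lt (v01 _ s2 i)) //.
    have f0 y : (forall i, `|sigma i (\val y)| <= D * `|sigma i (\val x)|) ->
        0 <= Num.floor (v y i * q.+1%:R).
      by move=> sy; rewrite floor_ge0 mulr_ge0 //; case/andP: (v01 _ sy i).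
    move/(congr1 Posz); rewrite !gez0_abs ?f0 // => /floor_eq_dist.
    rewrite -mulrBl normrM normr_nat -ltr_pdivlMr ?ltr0n // /v -mulrBl normrM.
    rewrite normfV (gtr0_norm E0) ltr_pdivrMr // mul1r opprD addrACA subrr addr0.
    rewrite -mulrBl normrM normfV normr_id ltr_pdivrMr // -rmorphB -rmorphB /=.
    have -> : `|sigma i (\val x)| * (E / q.+1%:R) = q.+1%:R^-1 * E * `|sigma i (\val
      x)| by rewrite mulrC [E / _]mulrC.
    exact.
  rewrite big_split /= prodr_const card_ord expr_div_n mulrA ler_pdivrMr ?exprn_gt0 //.
  by rewrite mul1r mulrC.
have [q0|q0] := posnP q.
  rewrite q0 expr1n exprMn -mulrA -[leLHS]mul1r ler_pM //.
  by rewrite exprn_ege1 // ler1n.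
have : q%:R ^+ n < V.
  by rewrite ltNge; apply/negP => /qmin; rewrite ltnn.
move/ltW; rewrite exprMn -mulrA -/V => qV.
apply: (@le_trans _ _ (2 ^+ n * q%:R ^+ n)); last by rewrite ler_wpM2l // exprn_ge0.
rewrite -exprMn lerXn2r ?nnegrE // -natrM ler_nat; lia.
Qed.

End IdealNorm.

Section IdealSquare.
Variables (R : realType) (K : fieldExtType rat) (n : nat).
Variable sigma : 'I_n -> {rmorphism K -> R}.
Hypothesis hn : \dim {:K} = n.
Hypothesis sigma_inj : forall i j, sigma i =1 sigma j -> i = j.

Lemma natr_eq0_numfield m : (m%:R == 0 :> K) = (m == 0%N).
Proof. by rewrite -(rmorph_nat (in_alg K)) fmorph_eq0 pnatr_eq0. Qed.

(** Take [x] of minimal norm in [I].  For [y] in [I], some [t * y / x] with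
    [0 < t <= M] is close to an integer [w]; then [t * y - w * x] is an element
    of [I] of smaller norm than [x], so it vanishes.  Hence [m] can be [M`!]. *)
Lemma ideal_nearly_principal : exists2 m : nat, (0 < m)%N &
  forall I : set (integers K), nonzero_ideal I ->
  exists x : integers K, [/\ I x, x != 0 &
    forall y, I y -> exists z, m%:R * y = x * z].
Proof.
have [M M0 MP] := hurwitz sigma hn.
exists M`! => [|I [Iid [x0 Ix0 x00]]]; first exact: fact_gt0.
have [I0 ID IM] := Iid.
pose P k := `[< exists x, [/\ I x, x != 0 & embnorm sigma (\val x) = k%:R] >].
have exP : exists k, P k.
  have [k kE] := embnorm_nat hn sigma_inj x0.
  by exists k; apply/asboolP; exists x0.
have [k /asboolP [x [Ix x_neq0 xk]] kmin] := ex_minnP exP.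
exists x; split=> // y Iy.
have [t [w /andP[t0 tM] tw]] := MP (\val y / \val x).
have ne0 : \val x != 0 by exact: x_neq0.
have : t%:R * y - w * x = 0.
  apply/eqP/negPn/negP => tn0.
  have [l lE] := embnorm_nat hn sigma_inj (t%:R * y - w * x).
  have : P l.
    apply/asboolP; exists (t%:R * y - w * x); split=> //.
    by apply: ID; [exact: IM|rewrite -mulNr; exact: IM].
  move=> /kmin; rewrite leqNgt => /negP; apply.
  rewrite -(ltr_nat R) -lE -xk.
  have -> : \val (t%:R * y - w * x) = (t%:R * (\val y / \val x) - \val w) * \val x.
    by rewrite rmorphB !rmorphM rmorph_nat mulrBl -mulrA divfK.
  by rewrite embnormM -[ltRHS]mul1r ltr_pM2r // embnorm_gt0.
move/subr0_eq => ty; exists ((M`! %/ t)%:R * w).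
have /divnK tf : (t %| M`!)%N by rewrite dvdn_fact // t0.
by rewrite -{1}tf natrM -mulrA ty; ring.
Qed.

(** After multiplication by [m ^+ 2] the determinant is a nonzero multiple of
    [x ^+ 2], with [x] as in [ideal_nearly_principal], and [N(I)] is bounded by
    the norm of [x]. *)
Lemma embnorm_det_ideal : exists2 C : R, 0 < C &
  forall I : set (integers K), nonzero_ideal I ->
  forall p q r s, I p -> I q -> I r -> I s -> p * s - q * r != 0 ->
    (ideal_norm I)%:R ^+ 2 <= C * embnorm sigma (\val (p * s - q * r)).
Proof.
have [C C0 CP] := ideal_norm_le_embnorm hn sigma_inj.
have [m m0 mP] := ideal_nearly_principal.
exists (C ^+ 2 * embnorm sigma (m%:R ^+ 2)) => [|I Inz p q r s Ip Iq Ir Is d0].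
  by rewrite mulr_gt0 ?exprn_gt0 // embnorm_gt0 // expf_neq0 // natr_eq0_numfield -lt0n.
have [x [Ix x0 xP]] := mP I Inz.
have [p' pE] := xP p Ip; have [q' qE] := xP q Iq.
have [r' rE] := xP r Ir; have [s' sE] := xP s Is.
have dE : m%:R ^+ 2 * (p * s - q * r) = x ^+ 2 * (p' * s' - q' * r').
  transitivity ((m%:R * p) * (m%:R * s) - (m%:R * q) * (m%:R * r)); first by ring.
  by rewrite pE qE rE sE; ring.
have d'0 : p' * s' - q' * r' != 0.
  apply: contraNneq d0 => e; move/eqP: dE; rewrite e mulr0 => /eqP.
  move/(congr1 (fun z : integers K => \val z)).
  rewrite rmorphM rmorphXn rmorph_nat => /eqP.
  by rewrite mulf_eq0 expf_eq0 natr_eq0_numfield eqn0Ngt m0 /=.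
apply: le_trans (_ : (C * embnorm sigma (\val x)) ^+ 2 <= _).
  rewrite lerXn2r ?nnegrE ?mulr_ge0 ?embnorm_ge0 ?(ltW C0) //.
  by apply: CP => //; case: Inz.
rewrite exprMn -mulrA ler_wpM2l ?exprn_ge0 ?(ltW C0) // -embnormM.
have -> : m%:R ^+ 2 * \val (p * s - q * r) = \val (x ^+ 2 * (p' * s' - q' * r')).
  by rewrite -dE rmorphM rmorphXn rmorph_nat.
rewrite rmorphM embnormM rmorphXn /= !expr2 embnormM ler_peMr ?mulr_ge0 ?embnorm_ge0 //.
exact: embnorm_ge1 d'0.
Qed.
End IdealSquare.

(** * Matrices of size two *)

Lemma det2E (A : comPzRingType) (g : 'M[A]_2) :
  \det g = g 0 0 * g 1 1 - g 0 1 * g 1 0.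
Proof.
have e (k : 'I_1) : lift 0 k = 1 :> 'I_2 by apply/val_inj; rewrite (ord1 k).
have e' (k : 'I_1) : lift 1 k = 0 :> 'I_2 by apply/val_inj; rewrite (ord1 k).
rewrite (expand_det_row _ 0) !big_ord_recl big_ord0 /cofactor.
rewrite !det_mx11 !mxE !e !e' /= addr0 expr0 mul1r.
by rewrite expr1 mulN1r mulrN.
Qed.

Lemma mulmx2E (A : pzRingType) (g h : 'M[A]_2) i j :
  (g *m h) i j = g i 0 * h 0 j + g i 1 * h 1 j.
Proof.
have e : lift ord0 ord0 = 1 :> 'I_2 by apply/val_inj.
by rewrite mxE !big_ord_recl big_ord0 addr0 e.
Qed.

Lemma forall_ord2 (P : 'I_2 -> Prop) : P 0 -> P 1 -> forall i, P i.
Proof.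
move=> P0 P1 [[|[|//]] lti].
- by have -> : Ordinal lti = 0 by apply/val_inj.
- by have -> : Ordinal lti = 1 by apply/val_inj.
Qed.

Lemma SL2_mul (A : comNzRingType) (g h : 'M[A]_2) : SL2 g -> SL2 h -> SL2 (g *m h).
Proof. by rewrite /SL2 /= det_mulmx => -> ->; rewrite mulr1. Qed.

Lemma SL2_adj (A : comNzRingType) (g : 'M[A]_2) : SL2 g -> SL2 (\adj g).
Proof.
rewrite /SL2 /= => g1; have := congr1 determinant (mul_mx_adj g).
by rewrite det_mulmx g1 mul1r det1.
Qed.

Lemma mxtrace2E (A : pzRingType) (g : 'M[A]_2) : \tr g = g 0 0 + g 1 1.
Proof.
have e : lift ord0 ord0 = 1 :> 'I_2 by apply/val_inj.
by rewrite /mxtrace !big_ord_recl big_ord0 addr0 e.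
Qed.

(** * The index of a congruence subgroup *)

Section Index.
Variable K : fieldExtType rat.
Variable I : set (integers K).
Hypothesis Iid : is_ideal I.
Local Notation O := (integers K).
Local Notation G := (congruence_subgroup I).

Lemma idealD x y : I x -> I y -> I (x + y). Proof. by case: Iid => _ H _; exact: H. Qed.
Lemma idealM a x : I x -> I (a * x). Proof. by case: Iid => _ _; apply. Qed.
Lemma idealMr x a : I x -> I (x * a). Proof. by rewrite mulrC; exact: idealM. Qed.
Lemma idealN x : I x -> I (- x). Proof. by rewrite -mulN1r; exact: idealM. Qed.
Lemma idealB x y : I x -> I y -> I (x - y). Proof. by move=> ? ?;
  apply/idealD/idealN. Qed.

Lemma ideal_mulmx (g h : 'M[O]_2) : (forall i j, I (h i j)) ->
  forall i j, I ((g *m h) i j).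
Proof. by move=> hI i j; rewrite mulmx2E; apply: idealD; apply: idealM. Qed.

Lemma congruent_quotient (g h : 'M[O]_2) : SL2 g -> SL2 h ->
  (forall i j, I ((h - g) i j)) -> G (\adj g *m h).
Proof.
move=> g1 h1 gh; split; first by apply: SL2_mul => //; exact: SL2_adj.
have -> : \adj g *m h - 1%:M = \adj g *m (h - g).
  by rewrite mulmxBr mul_adj_mx g1.
exact: ideal_mulmx.
Qed.

Lemma congruence_subgroup1 : G 1%:M.
Proof.
split=> [|i j]; first exact: det1.
by rewrite subrr mxE; case: Iid.
Qed.

Lemma congruence_subgroupM g h : G g -> G h -> G (g *m h).
Proof.
move=> [g1 gI] [h1 hI]; split=> [|i j]; first exact: SL2_mul.
have -> : g *m h - 1%:M = g *m (h - 1%:M) + (g - 1%:M).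
  by rewrite mulmxBr mulmx1 addrA subrK.
by rewrite mxE; apply: idealD => //; exact: ideal_mulmx.
Qed.

Lemma congruence_subgroup_adj g : G g -> G (\adj g).
Proof.
move=> [g1 gI]; rewrite -[\adj g]mulmx1; apply: congruent_quotient => // [|i j].
  exact: det1.
by rewrite -opprB mxE; exact: idealN.
Qed.

Lemma left_coset_eq (g k : 'M[O]_2) : G k ->
  [set g *m h | h in G] = [set (g *m k) *m h | h in G].
Proof.
move=> Gk; have [k1 _] := Gk; apply/seteqP; split=> _ [h Gh <-].
- exists (\adj k *m h).
    by apply: congruence_subgroupM => //; exact: congruence_subgroup_adj.
  by rewrite mulmxA -(mulmxA g) mul_mx_adj k1 mulmx1.
- by exists (k *m h); [exact: congruence_subgroupM|rewrite mulmxA].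
Qed.

Lemma residue_index : (0 < ideal_norm I)%N ->
  exists r : O -> 'I_(ideal_norm I), forall x y, r x = r y -> I (x - y).
Proof.
rewrite /ideal_norm /finite_card; set A := (X in fset_set X).
have [Afin _|Ainf] := pselect (finite_set A); last first.
  by rewrite /fset_set; case: pselect.
pose cs (x : O) := [set x + y | y in I].
have xA x : cs x \in fset_set A.
  by rewrite in_fset_set // inE; exists x.
have xi (x : O) : (index (cs x) (fset_set A) < size (fset_set A))%N.
  by rewrite index_mem.
exists (fun x : O => Ordinal (xi x)) => x y /(congr1 val) /= e.
have : cs x = cs y.
  by rewrite -(nth_index set0 (xA x)) e nth_index.
move/seteqP => [+ _] => /(_ x) []; first by exists 0; [case: Iid|rewrite addr0].
by move=> u Iu <-; rewrite addrC addKr.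
Qed.

(** A coset is determined by the first row of a representative modulo [I], and
    by one more residue: two matrices of determinant 1 with the same first row
    differ by a lower unipotent matrix, and [shear] is its parameter relative to
    a representative [base] chosen for each first row. *)
Lemma group_index_le : (0 < ideal_norm I)%N ->
  (group_index (@SL2 O) G <= ideal_norm I ^ 3)%N.
Proof.
move=> N0; have [r rP] := residue_index N0.
set N := ideal_norm I in r rP *.
pose row (g : 'M[O]_2) := (r (g 0 0), r (g 0 1)).
pose base ab := xget 1%:M [set g : 'M[O]_2 | SL2 g /\ row g = ab].
pose shear (g : 'M[O]_2) := g 1 0 * base (row g) 1 1 - g 1 1 * base (row g) 1 0.
pose rep (P : set 'M[O]_2) := xget 1%:M [set g | SL2 g /\ P = [set g *m h | h in G]].
pose code P := (row (rep P), r (shear (rep P))).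
have -> : (N ^ 3 = #|{: 'I_N * 'I_N * 'I_N}|)%N by rewrite !card_prod card_ord expnSr
  mulnn.
apply: (finite_card_le (f := code)) => P Q [g g1 gP] [g' g'1 gQ].
have [{}g1 {}gP] : SL2 (rep P) /\ P = [set rep P *m h | h in G].
  by apply: (@xgetPex _ _ [set g | SL2 g /\ P = [set g *m h | h in G]]); exists g.
have [{}g'1 {}gQ] : SL2 (rep Q) /\ Q = [set rep Q *m h | h in G].
  by apply: (@xgetPex _ _ [set g | SL2 g /\ Q = [set g *m h | h in G]]); exists g'.
rewrite /code; set h := rep P in g1 gP *; set h' := rep Q in g'1 gQ *.
move=> e; have rowE : row h = row h' by case: e => e1 e2 _; rewrite /row e1 e2.
have /rP : r (shear h) = r (shear h') by case: e.
rewrite /shear rowE; set k := base (row h').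
have [k1 kE] : SL2 k /\ row k = row h'.
  by apply: (@xgetPex _ _ [set g | SL2 g /\ row g = row h']); exists h'.
have sub00 : I (h 0 0 - k 0 0) by apply: rP; case: rowE; case: kE => -> _ ->.
have sub01 : I (h 0 1 - k 0 1) by apply: rP; case: rowE; case: kE => _ -> _ ->.
have sub00' : I (h' 0 0 - k 0 0) by apply: rP; case: kE => -> _.
have sub01' : I (h' 0 1 - k 0 1) by apply: rP; case: kE => _ ->.
move=> It.
rewrite /SL2 /= !det2E in g1 g'1 k1.
have row2 (u : 'M[O]_2) : u 0 0 * u 1 1 - u 0 1 * u 1 0 = 1 ->
    I (u 0 0 - k 0 0) -> I (u 0 1 - k 0 1) -> forall j, exists2 e, I e &
    u 1 j = (u 1 0 * k 1 1 - u 1 1 * k 1 0) * k 0 j + (1 + e) * k 1 j.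
  move=> u1 I0 I1 j.
  exists (u 1 0 * (u 0 1 - k 0 1) - u 1 1 * (u 0 0 - k 0 0)).
    by apply: idealB; apply: idealM.
  transitivity (u 1 j * (k 0 0 * k 1 1 - k 0 1 * k 1 0)); first by rewrite k1 mulr1.
  have -> : 1 + (u 1 0 * (u 0 1 - k 0 1) - u 1 1 * (u 0 0 - k 0 0))
     = u 1 1 * k 0 0 - u 1 0 * k 0 1 by rewrite -u1; ring.
  move: j; apply: forall_ord2; ring.
suff hh' : forall i j, I ((h' - h) i j).
  rewrite gP gQ (left_coset_eq h (congruent_quotient _ _ hh')); last 2 first.
  - by rewrite /SL2 /= det2E.
  - by rewrite /SL2 /= det2E.
  by rewrite mulmxA mul_mx_adj det2E g1 mul1mx.
apply: forall_ord2; last first.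
  move=> j; have [v Iv vE] := row2 _ g1 sub00 sub01 j.
  have [v' Iv' v'E] := row2 _ g'1 sub00' sub01' j.
  rewrite !mxE vE v'E.
  rewrite (_ : _ - _ = (- (h 1 0 * k 1 1 - h 1 1 * k 1 0 -
     (h' 1 0 * k 1 1 - h' 1 1 * k 1 0))) * k 0 j + (v' - v) * k 1 j); last by ring.
  by apply: idealD; apply: idealMr; [exact: idealN|exact: idealB].
apply: forall_ord2; rewrite !mxE.
- by rewrite -(subrKA (k 0 0)) -[X in _ + X]opprB; apply: idealB.
- by rewrite -(subrKA (k 0 1)) -[X in _ + X]opprB; apply: idealB.
Qed.

End Index.

(** * Hyperbolic functions *)

Section Cosh.
Variable R : realType.
Implicit Types a b x y : R.

Definition cosh a : R := (expR a + expR (- a)) / 2.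
Definition sinh a : R := (expR a - expR (- a)) / 2.

Lemma coshD a b : cosh (a + b) = cosh a * cosh b + sinh a * sinh b.
Proof. by rewrite /cosh /sinh opprD !expRD; field. Qed.

Lemma sqr_sinh a : sinh a ^+ 2 = cosh a ^+ 2 - 1.
Proof.
have := expRxMexpNx_1 a; rewrite /cosh /sinh => e.
apply/eqP; rewrite -subr_eq0; apply/eqP.
transitivity (1 - expR a * expR (- a)); first by field.
by rewrite e subrr.
Qed.

Lemma cosh_double a : cosh (a + a) = 2 * cosh a ^+ 2 - 1.
Proof. by rewrite coshD -expr2 -expr2 sqr_sinh; ring. Qed.

Lemma sinh_ge0 a : 0 <= a -> 0 <= sinh a.
Proof.
by move=> a0; rewrite divr_ge0 // subr_ge0 ler_expR; lra.
Qed.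

Lemma ltr_cosh a b : 0 <= a -> a < b -> cosh a < cosh b.
Proof.
move=> a0 ab; rewrite -subr_gt0.
have -> : cosh b - cosh a = (expR b - expR a) * (1 - expR (- a) * expR (- b)) / 2.
  have ea := expRxMexpNx_1 a; have eb := expRxMexpNx_1 b.
  transitivity ((expR b - expR a + (expR a * expR (- a)) * expR (- b)
     - (expR b * expR (- b)) * expR (- a)) / 2); last by ring.
  by rewrite ea eb /cosh; ring.
rewrite divr_gt0 // mulr_gt0 // subr_gt0 ?ltr_expR //.
by rewrite -expRD expR_lt1; lra.
Qed.

Lemma ler_cosh a b : 0 <= a -> 0 <= b -> (cosh a <= cosh b) = (a <= b).
Proof.
move=> a0 b0; have [|ab] := leP a b; last by apply/negbTE; rewrite -ltNge ltr_cosh.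
by rewrite le_eqVlt => /orP[/eqP ->|/(ltr_cosh a0)/ltW ->]; rewrite ?lexx.
Qed.

Lemma cosh_le_expR a : 0 <= a -> cosh a <= expR a.
Proof.
move=> a0; rewrite ler_pdivrMr //.
have : expR (- a) <= expR a by rewrite ler_expR; lra.
by lra.
Qed.

Lemma arcosh_ge0 x : 1 <= x -> 0 <= arcosh x.
Proof.
by move=> x1; rewrite ln_ge0 // (le_trans x1) // lerDl sqrtr_ge0.
Qed.

Lemma arcoshK x : 1 <= x -> cosh (arcosh x) = x.
Proof.
move=> x1; set s := Num.sqrt (x ^+ 2 - 1).
have s2 : s ^+ 2 = x ^+ 2 - 1 by rewrite sqr_sqrtr // subr_ge0 exprn_ege1.
have xs0 : 0 < x + s.
  by rewrite ltr_wpDr ?sqrtr_ge0 //; lra.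
rewrite /cosh /arcosh -/s expRN lnK ?posrE //.
have -> : (x + s)^-1 = x - s.
  apply: (mulIf (lt0r_neq0 xs0)); rewrite mulVf ?lt0r_neq0 //.
  by rewrite -subr_sqr s2 opprB addrC subrK.
by field.
Qed.

End Cosh.

(** * The metric of the hyperbolic plane *)

Section HalfPlane.
Local Open Scope complex_scope.
Variable R : realType.
Notation H2 := (@half_plane R).
Implicit Types z w : H2.

Definition re z : R := complex.Re (\val z).
Definition im z : R := complex.Im (\val z).

Lemma im_gt0 z : 0 < im z.
Proof. by case: z => z zP; exact: set_mem zP. Qed.

Lemma im_neq0 z : im z != 0. Proof. exact: lt0r_neq0 (im_gt0 z). Qed.

Fact mk_H2_subproof (x y : R) : 0 < y -> (x +i* y : (R[i])^o) \in @half_plane R.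
Proof. by move=> y0; apply/mem_set. Qed.
Definition mk_H2 (x y : R) (y0 : 0 < y) : H2 :=
  exist (fun u : (R[i])^o => u \in @half_plane R) _ (mk_H2_subproof x y0).

Lemma H2_eq z w : re z = re w -> im z = im w -> z = w.
Proof.
move=> r i; apply/val_inj; move: r i; rewrite /re /im.
by case: (\val z) => a b; case: (\val w) => c d /= -> ->.
Qed.

(** The hyperbolic cosine of the distance, in coordinates. *)
Definition coshd z w : R :=
  1 + ((re z - re w) ^+ 2 + (im z - im w) ^+ 2) / (2 * im z * im w).

Lemma coshd_ge1 z w : 1 <= coshd z w.
Proof.
rewrite lerDl divr_ge0 ?addr_ge0 ?sqr_ge0 //.
by rewrite !mulr_ge0 // ltW // im_gt0.
Qed.

Lemma dist_H2E z w : dist_H2 z w = arcosh (coshd z w).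
Proof.
by rewrite /dist_H2 /coshd /re /im /sqmod; case: (\val z) => a b; case: (\val w).
Qed.

Lemma dist_H2_ge0 z w : 0 <= dist_H2 z w.
Proof. by rewrite dist_H2E arcosh_ge0 // coshd_ge1. Qed.

Lemma cosh_dist z w : cosh (dist_H2 z w) = coshd z w.
Proof. by rewrite dist_H2E arcoshK // coshd_ge1. Qed.

Lemma coshdC z w : coshd z w = coshd w z.
Proof. by rewrite /coshd -(sqrrN (re z - _)) -(sqrrN (im z - _)) !opprB mulrAC. Qed.

Lemma dist_H2C z w : dist_H2 z w = dist_H2 w z.
Proof. by rewrite !dist_H2E coshdC. Qed.

Lemma dist_H2xx z : dist_H2 z z = 0.
Proof.
by rewrite dist_H2E /coshd !subrr expr0n addr0 mul0r addr0 /arcosh expr1n subrr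
  sqrtr0 addr0 ln1.
Qed.

(** In the hyperboloid model the three cosines are the scalar products of three
    unit vectors, and the inequality says that their Gram determinant is
    nonnegative; it is a square, that of their mixed product. *)
Lemma dist_H2_triangle z t w : dist_H2 z w <= dist_H2 z t + dist_H2 t w.
Proof.
rewrite -ler_cosh ?addr_ge0 ?dist_H2_ge0 // coshD !cosh_dist.
set s := sinh _ * sinh _; have s0 : 0 <= s by rewrite mulr_ge0 ?sinh_ge0 ?dist_H2_ge0.
have : (coshd z w - coshd z t * coshd t w) ^+ 2 <= s ^+ 2.
  rewrite exprMn !sqr_sinh !cosh_dist -subr_ge0.
  have -> : (coshd z t ^+ 2 - 1) * (coshd t w ^+ 2 - 1)
     - (coshd z w - coshd z t * coshd t w) ^+ 2 =
    (((re t - re z) * (re w ^+ 2 + im w ^+ 2 - re z ^+ 2 - im z ^+ 2)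
     - (re w - re z) * (re t ^+ 2 + im t ^+ 2 - re z ^+ 2 - im z ^+ 2))
     / (2 * im z * im t * im w)) ^+ 2.
    by rewrite /coshd; field; rewrite !im_neq0.
  exact: sqr_ge0.
rewrite -ler_sqrt ?sqr_ge0 // !sqrtr_sqr (ger0_norm s0) => h.
by have := le_trans (ler_norm _) h; lra.
Qed.

(** In the hyperboloid model [z] is the vector
    [(1, re z, re z ^ 2 + im z ^ 2) / im z], of square 1.  The vector [(a, b, c)]
    below is [z + w - 2 * u * m].  The hypotheses say that it is orthogonal to
    the timelike vector [m] and has square 0, so it vanishes. *)
Lemma midpoint_height z m w :
  dist_H2 z m = dist_H2 m w -> dist_H2 z w = dist_H2 z m + dist_H2 z m ->
  im m ^+ 2 = im z * im w * (1 + ((re z - re w) / (im z + im w)) ^+ 2) /\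
  re z / im z + re w / im w = (1 / im z + 1 / im w) * re m.
Proof.
move=> e1 e2; set u := coshd z m.
have mw : coshd m w = u by rewrite /u -!cosh_dist e1.
have zw : coshd z w = 2 * u ^+ 2 - 1 by rewrite -cosh_dist e2 cosh_double cosh_dist.
have [zy my wy] := And3 (im_neq0 z) (im_neq0 m) (im_neq0 w).
pose a := 1 / im z + 1 / im w - 2 * u / im m.
pose b := re z / im z + re w / im w - 2 * u * re m / im m.
pose c := (re z ^+ 2 + im z ^+ 2) / im z + (re w ^+ 2 + im w ^+ 2) / im w
   - 2 * u * (re m ^+ 2 + im m ^+ 2) / im m.
have orth : a * (re m ^+ 2 + im m ^+ 2) + c = 2 * b * re m.
  apply/eqP; rewrite -subr_eq0; apply/eqP.
  transitivity (2 * im m * (coshd z m - u) + 2 * im m * (coshd m w - u)); last first.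
    by rewrite mw -/u !subrr !mulr0 addr0.
  by rewrite /a /b /c /coshd; field; rewrite zy my wy.
have null : a * c = b ^+ 2.
  apply/eqP; rewrite -subr_eq0; apply/eqP.
  transitivity (2 * (coshd z w - (2 * u ^+ 2 - 1)) - 4 * u * (coshd z m - u)
      - 4 * u * (coshd m w - u)); last first.
    by rewrite mw zw -/u !subrr !mulr0 !subr0.
  by rewrite /a /b /c /coshd; field; rewrite zy my wy.
have : (a * re m - b) ^+ 2 + (a * im m) ^+ 2 = 0.
  transitivity (a * (a * (re m ^+ 2 + im m ^+ 2) + c) - 2 * a * b * re m
     - (a * c - b ^+ 2)); first by ring.
  by rewrite orth null; ring.
move/eqP; rewrite paddr_eq0 ?sqr_ge0 // !sqrf_eq0 mulf_eq0 (negbTE my) orbF.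
move=> /andP[/eqP ab /eqP a0]; move: ab; rewrite a0 mul0r sub0r => /eqP.
rewrite oppr_eq0 => /eqP b0.
have uE : 2 * u / im m = 1 / im z + 1 / im w by move/eqP: a0;
  rewrite subr_eq0 => /eqP ->.
split; last first.
  move/eqP: b0; rewrite subr_eq0 => /eqP ->; rewrite -uE; field; exact: my.
have s0 : im z + im w != 0 by rewrite lt0r_neq0 // addr_gt0 ?im_gt0.
have u2 : 4 * u ^+ 2 = 2 * coshd z w + 2 by rewrite zw; ring.
have : im m * (im z + im w) = 2 * u * (im z * im w).
  have -> : 2 * u = (1 / im z + 1 / im w) * im m by rewrite -uE divfK.
  by field; rewrite zy wy.
move/(congr1 (fun x => x ^+ 2)); rewrite !exprMn (_ : 2 ^+ 2 = 4); last by ring.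
rewrite u2 /coshd => e; have s20 : (im z + im w) ^+ 2 != 0 by rewrite expf_neq0.
apply: (mulIf s20); rewrite e.
by field; rewrite zy wy s0.
Qed.

End HalfPlane.

(** * The action of real matrices on the hyperbolic plane *)

Section Mobius.
Local Open Scope complex_scope.
Variable R : realType.
Notation H2 := (@half_plane R).
Implicit Types (z w : H2) (g h : 'M[R]_2).

Definition den g z : R := (g 1 0 * re z + g 1 1) ^+ 2 + (g 1 0 * im z) ^+ 2.

Lemma SL2E g : SL2 g -> g 0 0 * g 1 1 - g 0 1 * g 1 0 = 1.
Proof. by rewrite /SL2 /= det2E. Qed.

Lemma den_gt0 g z : SL2 g -> 0 < den g z.
Proof.
move=> /SL2E g1; rewrite lt0r addr_ge0 ?sqr_ge0 // andbT.
rewrite /den paddr_eq0 ?sqr_ge0 // !sqrf_eq0 mulf_eq0 (negbTE (im_neq0 z)) orbF.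
apply/negP => /andP[/eqP e /eqP c0]; move: g1 e; rewrite c0 mul0r add0r => + d0.
by rewrite d0 !mulr0 subr0 => /esym/eqP; rewrite oner_eq0.
Qed.

Lemma re_mobius g z : SL2 g -> re (mobius g z) =
  ((g 0 0 * re z + g 0 1) * (g 1 0 * re z + g 1 1) + g 0 0 * g 1 0 * im z ^+ 2) / den
    g z.
Proof.
move=> g1; have := den_gt0 z g1; rewrite /den /re /im val_mobius // /frac_lin.
case: (\val z) => x y /= D0.
rewrite !mul0r !subr0 !addr0; field; exact: lt0r_neq0.
Qed.

Lemma im_mobius g z : SL2 g -> im (mobius g z) = im z / den g z.
Proof.
move=> g1; have := den_gt0 z g1; rewrite /den /re /im val_mobius // /frac_lin.
case: (\val z) => x y /= D0.
rewrite !mul0r !subr0 !addr0.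
transitivity ((g 0 0 * g 1 1 - g 0 1 * g 1 0) * y /
  ((g 1 0 * x + g 1 1) ^+ 2 + (g 1 0 * y) ^+ 2)); last by rewrite SL2E // mul1r.
by field; exact: lt0r_neq0.
Qed.

Lemma denominator_neq0 g z : SL2 g -> (g 1 0)%:C * \val z + (g 1 1)%:C != 0 :> R[i].
Proof.
move=> g1; have := den_gt0 z g1; rewrite /den /re /im.
case: (\val z) => x y /= D0; apply/eqP => -[]; rewrite !mul0r !subr0 !addr0 => e1 e2.
by move: D0; rewrite e1 e2 !expr0n addr0 ltxx.
Qed.

Lemma fractional_linear_comp (F : fieldType) (a b c d a' b' c' d' w : F) :
  c' * w + d' != 0 -> c * ((a' * w + b') / (c' * w + d')) + d != 0 ->
  ((a * a' + b * c') * w + (a * b' + b * d')) / ((c * a' + d * c') * w + (c * b' + d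
    * d'))
  = (a * ((a' * w + b') / (c' * w + d')) + b) / (c * ((a' * w + b') / (c' * w + d'))
    + d).
Proof.
set v := (a' * w + b') / (c' * w + d') => d1 d2.
have vE : v * (c' * w + d') = a' * w + b' by rewrite divfK.
have -> : (a * a' + b * c') * w + (a * b' + b * d') = (a * v + b) * (c' * w + d').
  by transitivity (a * (v * (c' * w + d')) + b * (c' * w + d')); [rewrite vE|]; ring.
have -> : (c * a' + d * c') * w + (c * b' + d * d') = (c * v + d) * (c' * w + d').
  by transitivity (c * (v * (c' * w + d')) + d * (c' * w + d')); [rewrite vE|]; ring.
by rewrite -mulf_div divff // mulr1.
Qed.

Lemma mobiusM g h z : SL2 g -> SL2 h -> mobius (g *m h) z = mobius g (mobius h z).
Proof.
move=> g1 h1; have gh1 := SL2_mul g1 h1.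
apply/val_inj; rewrite !val_mobius // /frac_lin.
have d2 := denominator_neq0 (mobius h z) g1; rewrite val_mobius // /frac_lin in d2.
rewrite !mulmx2E !rmorphD !rmorphM.
exact: fractional_linear_comp (denominator_neq0 z h1) d2.
Qed.

Lemma mobius1 z : mobius 1%:M z = z.
Proof.
have SL1 : SL2 (1%:M : 'M[R]_2) by exact: det1.
have d1 : den 1%:M z = 1 by rewrite /den !mxE /=; ring.
by apply: H2_eq; rewrite ?re_mobius ?im_mobius // d1 divr1 ?mxE /=; ring.
Qed.

(** [g z - g w] is [(z - w) / ((c * z + d) * (c * w + d))], and [P], [Q] are the
    real and imaginary parts of [(c * z + d) * (c * w + d)]. *)
Lemma mobius_isometry g z w : SL2 g -> dist_H2 (mobius g z) (mobius g w) = dist_H2 z w.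
Proof.
move=> g1; rewrite !dist_H2E; congr arcosh; rewrite /coshd; congr (1 + _).
rewrite !re_mobius // !im_mobius //.
have := lt0r_neq0 (den_gt0 z g1); have := lt0r_neq0 (den_gt0 w g1).
have := im_neq0 z; have := im_neq0 w.
set D := den g z; set E := den g w => w0 z0 E0 D0.
pose P := (g 1 0 * re z + g 1 1) * (g 1 0 * re w + g 1 1) - g 1 0 ^+ 2 * im z * im w.
pose Q := g 1 0 * (im z * (g 1 0 * re w + g 1 1) + im w * (g 1 0 * re z + g 1 1)).
have PQ : P ^+ 2 + Q ^+ 2 = D * E by rewrite /P /Q /D /E /den; ring.
set a := g 0 0; set b := g 0 1; set c := g 1 0; set d := g 1 1.
have reE : ((a * re z + b) * (c * re z + d) + a * c * im z ^+ 2) / D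
   - ((a * re w + b) * (c * re w + d) + a * c * im w ^+ 2) / E
   = ((re z - re w) * P + (im z - im w) * Q) / (D * E).
  transitivity ((a * d - b * c) * ((re z - re w) * P + (im z - im w) * Q) / (D * E)).
    rewrite -[LHS](mulfK (mulf_neq0 D0 E0)); congr (_ / _).
    transitivity (((a * re z + b) * (c * re z + d) + a * c * im z ^+ 2) * E
      - ((a * re w + b) * (c * re w + d) + a * c * im w ^+ 2) * D).
      by field; rewrite D0 E0.
    by rewrite /P /Q /D /E /den -/c -/d; ring.
  by rewrite SL2E // mul1r.
have imE : im z / D - im w / E = ((im z - im w) * P - (re z - re w) * Q) / (D * E).
  rewrite -[LHS](mulfK (mulf_neq0 D0 E0)); congr (_ / _).
  transitivity (im z * E - im w * D); first by field; rewrite D0 E0.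
  by rewrite /P /Q /D /E /den -/c -/d; ring.
rewrite reE imE.
transitivity (((re z - re w) ^+ 2 + (im z - im w) ^+ 2) * (P ^+ 2 + Q ^+ 2)
   / (D * E * (2 * im z * im w))).
  by field; rewrite z0 w0 D0 E0.
by rewrite PQ; field; rewrite z0 w0 D0 E0.
Qed.

End Mobius.

(** * Displacement functions *)

Section Displacement.
Variable R : realType.
Notation H2 := (@half_plane R).
Implicit Types (z w : H2) (g h : 'M[R]_2).

(** With [A] and [B] the real and imaginary parts of
    [c * z ^ 2 + (d - a) * z - b], which is [(z - g z) * (c * z + d)], the
    displacement is given by [A ^ 2 + B ^ 2], and completing the square brings
    out the discriminant [\tr g ^ 2 - 4] of the fixed point equation. *)
Lemma coshd_mobius g z : SL2 g -> coshd z (mobius g z) = 1 +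
  ((g 1 0 * re z ^+ 2 + (g 1 1 - g 0 0) * re z - g 0 1 + g 1 0 * im z ^+ 2) ^+ 2
   + im z ^+ 2 * (\tr g ^+ 2 - 4)) / (2 * im z ^+ 2).
Proof.
move=> g1; rewrite /coshd re_mobius // im_mobius // mxtrace2E.
have g1E := SL2E g1; have := im_neq0 z; have := lt0r_neq0 (den_gt0 z g1).
rewrite /den; move: (re z) (im z) g1E => x y.
move: (g 0 0) (g 0 1) (g 1 0) (g 1 1) => a b c d g1E.
set P := c * x + d; set Q := c * y; set D := P ^+ 2 + Q ^+ 2 => D0 y0.
pose A := c * (x ^+ 2 - y ^+ 2) + (d - a) * x - b.
pose B := y * (2 * c * x + d - a).
have -> : x - ((a * x + b) * P + a * c * y ^+ 2) / D = (A * P + B * Q) / D.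
  have -> : A * P + B * Q = x * D - ((a * x + b) * P + a * c * y ^+ 2).
    by rewrite /D /P /Q /A /B; ring.
  by field.
have -> : y - y / D = (B * P - A * Q) / D.
  have -> : B * P - A * Q = y * D - y * (a * d - b * c).
    by rewrite /D /P /Q /A /B; ring.
  by rewrite g1E; field.
have -> : (c * x ^+ 2 + (d - a) * x - b + c * y ^+ 2) ^+ 2 + y ^+ 2 * ((a + d) ^+ 2 - 4)
    = A ^+ 2 + B ^+ 2.
  have -> : 4 = 4 * (a * d - b * c) by rewrite g1E mulr1.
  by rewrite /A /B; ring.
transitivity (1 + (A ^+ 2 + B ^+ 2) * D / (2 * y ^+ 2 * D)); last by field;
  rewrite D0 y0.
have -> : (A ^+ 2 + B ^+ 2) * D = (A * P + B * Q) ^+ 2 + (B * P - A * Q) ^+ 2.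
  by rewrite /D; ring.
by field; rewrite D0 y0.
Qed.

Lemma coshd_mobius_trace g z : SL2 g -> \tr g ^+ 2 / 2 - 1 <= coshd z (mobius g z).
Proof.
move=> g1; rewrite coshd_mobius // mulrDl; have y0 := im_neq0 z.
set U := (X in 1 + (X + _)); have U0 : 0 <= U by rewrite divr_ge0 ?sqr_ge0 //
  mulr_ge0 ?sqr_ge0.
have -> : im z ^+ 2 * (\tr g ^+ 2 - 4) / (2 * im z ^+ 2) = \tr g ^+ 2 / 2 - 2 by field.
by lra.
Qed.

(** The constant comes from [(t - 2) ^ 2 <= 2 * t ^ 2 + 8], together with
    [t ^ 2 / 2 - 1 <= exp d] and [1 <= exp d]. *)
Lemma trace_displacement g z : SL2 g ->
  (\tr g - 2) ^+ 2 <= 16 * expR (dist_H2 z (mobius g z)).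
Proof.
move=> g1; have := coshd_mobius_trace z g1.
rewrite -cosh_dist; set d := dist_H2 _ _.
have d0 : 0 <= d by exact: dist_H2_ge0.
have := cosh_le_expR d0; have : 1 <= expR d by rewrite -expR0 ler_expR.
by move: (cosh d) (expR d) => u v h1 h2 h3; have := sqr_ge0 (\tr g + 2); nra.
Qed.

Lemma parabolic_displacement g z : SL2 g -> \tr g = 2 ->
  g 1 0 ^+ 2 * im z ^+ 2 / 2 <= coshd z (mobius g z) - 1.
Proof.
move=> g1 g2; have g1E := SL2E g1.
rewrite coshd_mobius // g2 (_ : 2 ^+ 2 - 4 = 0) ?mulr0 ?addr0; last by ring.
have y0 := im_gt0 z; move: (re z) (im z) y0 => x y y0.
rewrite mxtrace2E in g2; move: (g 0 0) (g 0 1) (g 1 0) (g 1 1) g1E g2 => a b c d g1E g2.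
set U := _ + c * y ^+ 2.
have [->|c0] := eqVneq c 0.
  by rewrite expr0n !mul0r addrAC subrr add0r divr_ge0 ?sqr_ge0 // mulr_ge0 ?sqr_ge0.
have cU : c * U = (c * x + (d - a) / 2) ^+ 2 + c ^+ 2 * y ^+ 2.
  have aE : a = 2 - d by rewrite -g2 addrK.
  have bE : c * b = (2 - d) * d - 1.
    by transitivity (a * d - (a * d - b * c)); [ring|rewrite g1E aE].
  transitivity (c ^+ 2 * x ^+ 2 + c * (d - a) * x - c * b + c ^+ 2 * y ^+ 2).
    by rewrite /U; ring.
  by rewrite bE aE; field.
have {}cU : c ^+ 2 * y ^+ 2 <= c * U by rewrite cU lerDr sqr_ge0.
have : (c ^+ 2 * y ^+ 2) ^+ 2 <= (c * U) ^+ 2.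
  by rewrite lerXn2r ?nnegrE ?(le_trans _ cU) // mulr_ge0 ?sqr_ge0.
have c2 : 0 < c ^+ 2 by rewrite lt0r sqrf_eq0 c0 sqr_ge0.
have -> : (c ^+ 2 * y ^+ 2) ^+ 2 = c ^+ 2 * (c ^+ 2 * y ^+ 2 * y ^+ 2) by ring.
rewrite exprMn ler_pM2l // => h.
rewrite addrAC subrr add0r ler_pdivlMr ?mulr_gt0 ?exprn_gt0 //.
apply: le_trans h; rewrite le_eqVlt; apply/orP; left; apply/eqP; by field.
Qed.

Lemma unipotent_upper g : SL2 g -> \tr g = 2 -> g 1 0 = 0 -> g 0 0 = 1 /\ g 1 1 = 1.
Proof.
move=> /SL2E + + c0; rewrite c0 mulr0 subr0 mxtrace2E => ad1 ad2.
have aE : g 0 0 = 2 - g 1 1 by rewrite -ad2 addrK.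
have : (g 1 1 - 1) ^+ 2 = 0.
  by transitivity (1 - (2 - g 1 1) * g 1 1); [ring|rewrite -aE ad1 subrr].
move/eqP; rewrite sqrf_eq0 subr_eq0 => /eqP d1; split=> //.
by rewrite aE d1; ring.
Qed.

Lemma upper_displacement g z : SL2 g -> \tr g = 2 -> g 1 0 = 0 ->
  coshd z (mobius g z) - 1 = g 0 1 ^+ 2 / (2 * im z ^+ 2).
Proof.
move=> g1 g2 c0; have [a1 d1] := unipotent_upper g1 g2 c0.
rewrite coshd_mobius // g2 c0 a1 d1; field; exact: im_neq0.
Qed.

Definition mx2 (A : Type) (a b c d : A) : 'M[A]_2 :=
  \matrix_(i, j) if i == 0 then if j == 0 then a else b else if j == 0 then c else d.

(** Conjugate by a matrix that sends the fixed point of [g] to infinity. *)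
Lemma parabolic_conj g : SL2 g -> \tr g = 2 -> g <> 1%:M ->
  exists (h : 'M[R]_2) (b : R), [/\ SL2 h, b != 0 &
   forall z, re (mobius h (mobius g z)) = re (mobius h z) + b /\
             im (mobius h (mobius g z)) = im (mobius h z)].
Proof.
move=> g1 g2 gn1; have g1E := SL2E g1; have t2 := g2; rewrite mxtrace2E in g2.
have SLT b : SL2 (mx2 1 b 0 1 : 'M[R]_2).
  by rewrite /SL2 /= det2E !mxE /=; ring.
have reT b z : re (mobius (mx2 1 b 0 1) z) = re z + b.
  by rewrite re_mobius // /den !mxE /= !mul0r !add0r !expr1n expr0n addr0 divr1; ring.
have imT b z : im (mobius (mx2 1 b 0 1) z) = im z.
  by rewrite im_mobius // /den !mxE /= !mul0r !add0r !expr1n expr0n addr0 divr1.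
suff [h [b [h1 b0 hgE]]] : exists (h : 'M[R]_2) (b : R),
    [/\ SL2 h, b != 0 & h *m g = mx2 1 b 0 1 *m h].
  exists h, b; split=> // z.
  by rewrite -mobiusM // hgE mobiusM // reT imT.
have [c0|c0] := eqVneq (g 1 0) 0.
  have [a1 d1] := unipotent_upper g1 t2 c0.
  exists 1%:M, (g 0 1); split; first exact: det1.
    apply/eqP => b0; apply: gn1; apply/matrixP; apply: forall_ord2; apply: forall_ord2;
    by rewrite !mxE ?a1 ?d1 ?c0 ?b0.
  rewrite mul1mx mulmx1; apply/matrixP; apply: forall_ord2; apply: forall_ord2;
  by rewrite !mxE ?a1 ?d1 ?c0.
pose x := (g 0 0 - g 1 1) / (2 * g 1 0).
(* [x] is the fixed point of [g], and the conjugation is by [z |-> -1 / (z - x)]. *)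
exists (mx2 0 (-1) 1 (- x)), (- g 1 0); split; rewrite ?oppr_eq0 //.
  by rewrite /SL2 /= det2E !mxE /=; ring.
have aE : g 0 0 = 2 - g 1 1 by rewrite -g2 addrK.
have bE : g 0 1 = ((2 - g 1 1) * g 1 1 - 1) / g 1 0.
  transitivity ((g 0 0 * g 1 1 - (g 0 0 * g 1 1 - g 0 1 * g 1 0)) / g 1 0);
    first by field.
  by rewrite g1E aE.
apply/matrixP; apply: forall_ord2; apply: forall_ord2;
  rewrite !mulmx2E !mxE /= /x ?bE ?aE; by field.
Qed.

(** Proximity for the hyperbolic metric implies proximity of the coordinates;
    the bound [im w <= 4 * im z] for close points makes the factor [im w] of the
    denominator of [coshd] harmless. *)
Lemma dist_H2_coord z (e : R) : 0 < e -> exists2 r : R, 0 < r &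
  forall w, dist_H2 z w < r -> `|re z - re w| < e /\ `|im z - im w| < e.
Proof.
move=> e0; pose k := Num.min 1 (e ^+ 2 / (8 * im z ^+ 2)).
have y0 := im_gt0 z.
have k0 : 0 < k by rewrite lt_min ltr01 divr_gt0 ?mulr_gt0 ?exprn_gt0.
have k1 : k <= 1 by rewrite ge_min lexx.
have ke : 8 * im z ^+ 2 * k <= e ^+ 2.
  by rewrite mulrC -ler_pdivlMr ?mulr_gt0 ?exprn_gt0 // ge_min lexx orbT.
have k1' : 1 <= 1 + k by lra.
exists (arcosh (1 + k)) => [|w].
  rewrite lt0r arcosh_ge0 // andbT; apply: contraTneq k0 => k0.
  by have := arcoshK k1'; rewrite k0 /cosh oppr0 expR0; lra.
move/(ltr_cosh (dist_H2_ge0 z w)); rewrite cosh_dist arcoshK // /coshd.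
have yw0 := im_gt0 w; rewrite ltrD2l ltr_pdivrMr ?mulr_gt0 //.
move: (re z) (im z) (re w) (im w) y0 yw0 ke => x y u v y0 v0 ke h.
have v4 : v <= 4 * y.
  have : (y - v) ^+ 2 < 2 * y * v.
    have : k * (2 * y * v) <= 2 * y * v by rewrite ler_piMl // !mulr_ge0 // ltW.
    by have := sqr_ge0 (x - u); lra.
  by move=> h'; rewrite leNgt; apply/negP => vy; nra.
have S : (x - u) ^+ 2 + (y - v) ^+ 2 < e ^+ 2.
  apply: (lt_le_trans h); apply: le_trans ke.
  rewrite [leRHS]mulrC ler_pM2l //; nra.
have sq (t : R) : t ^+ 2 < e ^+ 2 -> `|t| < e.
  by rewrite -[t ^+ 2]real_normK ?num_real // ltr_pXn2r ?nnegrE // ltW.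
by split; apply: sq; [have := sqr_ge0 (y - v)|have := sqr_ge0 (x - u)]; lra.
Qed.

End Displacement.

(** * Lifting local geodesics through a quotient by isometries *)

(** Real induction: a transitive relation that holds locally around each point
    of an interval holds between its ends. *)
Lemma interval_creep (R : realType) (P : R -> R -> Prop) (a b : R) : a <= b ->
  (forall s t u, s <= t <= u -> P s t -> P t u -> P s u) ->
  (forall t, a <= t <= b -> exists2 r, 0 < r &
     forall s u, a <= s <= t -> t <= u <= b -> t - r < s -> u < t + r -> P s u) ->
  P a b.
Proof.
move=> ab Ptr Ploc; pose S := [set t | a <= t <= b /\ P a t].
have Sa : S a.
  split; first by rewrite lexx.
  have [|r r0 Pa] := Ploc a; first by rewrite lexx.
  by apply: Pa; rewrite ?lexx ?ab //; lra.
have hS : has_sup S by split; [exists a|exists b => t [/andP[]]].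
have ubS t : S t -> t <= sup S by move=> St; exact: sup_upper_bound hS _ St.
have lea : a <= sup S by exact: ubS.
have leb : sup S <= b by apply: ge_sup; [exists a|move=> t [/andP[]]].
have [|r r0 Pr] := Ploc (sup S); first by rewrite lea.
have [t [/andP[at_ tb] Pat] tr] := sup_adherent r0 hS.
have St : t <= sup S by apply: ubS; split=> //; rewrite at_.
have reach u : sup S <= u <= b -> u < sup S + r -> P a u.
  move=> /andP[su ub] ur; apply: (Ptr a t u) => //; first by rewrite at_ (le_trans St).
  by apply: Pr => //; rewrite ?at_ ?St ?su ?ub.
have [sb|] := ltP (sup S) b; last by move=> bs; apply: reach;
  rewrite ?leb ?bs ?lexx //; lra.
exfalso; pose u := Num.min b (sup S + r / 2).
have su : sup S < u by rewrite lt_min sb /=; lra.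
have ub : u <= b by rewrite ge_min lexx.
have ur : u < sup S + r by rewrite gt_min; apply/orP; right; lra.
have : S u by split; [rewrite ub (le_trans lea) // ltW|apply: reach => //;
  rewrite ub ltW].
by move/ubS; rewrite leNgt su.
Qed.

(** The quotient of a metric space by a group of isometries is only used through
    the following data: the projection [p] has isometries over the quotient
    between any two points of a fibre, and around each point of [X] there is a
    ball on which [p] is injective. *)
Section Lift.
Variables (R : realType) (X Q : Type) (d : X -> X -> R) (p : X -> Q).
Hypothesis d_ge0 : forall x y, 0 <= d x y.
Hypothesis dxx : forall x, d x x = 0.
Hypothesis dC : forall x y, d x y = d y x.
Hypothesis d_triangle : forall x y z, d x z <= d x y + d y z.
Hypothesis p_surj : forall q, exists x, p x = q.
Hypothesis deck : forall x y, p x = p y -> exists phi : X -> X,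
  [/\ phi x = y, forall u v, d (phi u) (phi v) = d u v & forall u, p (phi u) = p u].
Hypothesis discrete : forall z, exists2 e, 0 < e &
  forall w w', p w = p w' -> d z w < e -> d z w' < e -> w = w'.

Definition quotient_metric (a b : Q) : R :=
  inf [set r | exists z w, [/\ p z = a, p w = b & r = d z w]].

Lemma quotient_metric_le z w : quotient_metric (p z) (p w) <= d z w.
Proof.
apply: ge_inf; last by exists z, w.
by exists 0 => _ [? [? [_ _ ->]]].
Qed.

Lemma quotient_metric_approx z b e : quotient_metric (p z) b < e ->
  exists2 w, p w = b & d z w < e.
Proof.
have [w0 w0b] := p_surj b.
move=> /inf_lt[|_ [z' [w' [z'z w'b ->]]] lte]; first by exists (d z w0), z, w0.
have [phi [phiz phid phip]] := deck z'z.
by exists (phi w'); [rewrite phip|rewrite -phiz phid].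
Qed.

Definition metric_continuous (f : R -> X) := forall t e, 0 < e ->
  exists2 r, 0 < r & forall s, `|s - t| < r -> d (f t) (f s) < e.

Variable c : R -> Q.
Hypothesis c_geodesic : forall t, exists2 e, 0 < e & forall s u,
  `|s - t| < e -> `|u - t| < e -> quotient_metric (c s) (c u) = `|s - u|.

(** Lift [c s] to the point of its fibre nearest to [z]; injectivity of [p] near
    [z] makes the distances of the lifts equal to those in the quotient. *)
Lemma local_lift t z : p z = c t -> exists r (l : R -> X), [/\ 0 < r,
  forall s, `|s - t| < r -> p (l s) = c s &
  forall s u, `|s - t| < r -> `|u - t| < r -> d (l s) (l u) = `|s - u|].
Proof.
move=> zt; have [e e0 He] := discrete z; have [r r0 Hr] := c_geodesic t.
pose k := Num.min r (e / 4); have k0 : 0 < k by rewrite lt_min r0 divr_gt0.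
have kr s : `|s - t| < k -> `|s - t| < r by rewrite lt_min => /andP[].
have ke s : `|s - t| < k -> `|s - t| < e / 4 by rewrite lt_min => /andP[].
have tt : `|t - t| < r by rewrite subrr normr0.
(* A quarter of [e] leaves room for the distance between two lifts, which is at
   most [e / 2], when their distances to [z] are compared with [e]. *)
have : forall s, exists w, `|s - t| < k -> p w = c s /\ d z w < e / 4.
  move=> s; have [sk|] := ltP `|s - t| k; last by exists z.
  have : quotient_metric (p z) (c s) < e / 4 by rewrite zt Hr ?tt ?kr // distrC ke.
  by case/quotient_metric_approx => w; exists w.
move=> /choice [l lP]; exists k, l; split=> //= [s /lP[]//|s u sk uk].
have [ls zs] := lP s sk; have [lu zu] := lP u uk.
apply/eqP; rewrite eq_le; apply/andP; split; last first.
  by rewrite -(Hr s u) ?kr // -ls -lu quotient_metric_le.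
apply/ler_addgt0Pr => n n0; pose m := Num.min n (e / 4).
have m0 : 0 < m by rewrite lt_min n0 divr_gt0.
have mn : m <= n by rewrite ge_min lexx.
have me : m <= e / 4 by rewrite ge_min lexx orbT.
have : quotient_metric (p (l s)) (c u) < `|s - u| + m.
  by rewrite ls Hr ?kr //; lra.
case/quotient_metric_approx => w wu dw.
have su : `|s - u| <= `|s - t| + `|u - t| by rewrite (distrC u); exact: ler_distD.
have := ke s sk; have := ke u uk => ? ?.
suff -> : l u = w by lra.
apply: He; first by rewrite lu wu.
  by lra.
by have := d_triangle z (l s) w; lra.
Qed.

Lemma metric_continuous_glue f g t : metric_continuous f -> metric_continuous g ->
  f t = g t -> metric_continuous (fun x => if x <= t then f x else g x).
Proof.
move=> cf cg fg x e e0; have [r r0 fr] := cf x e e0; have [k k0 gk] := cg x e e0.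
have [xt|tx|xt] := ltgtP x t.
- exists (Num.min r (t - x)) => [|s]; first by rewrite lt_min r0 subr_gt0.
  rewrite lt_min => /andP[sr st]; have := ler_norm (s - x) => ?.
  by rewrite ifT; [exact: fr|lra].
- exists (Num.min k (x - t)) => [|s]; first by rewrite lt_min k0 subr_gt0.
  rewrite lt_min => /andP[sk st]; have := ler_norm (x - s); rewrite distrC => ?.
  by rewrite ifF; [exact: gk|apply/negbTE; rewrite -ltNge; lra].
exists (Num.min r k) => [|s]; first by rewrite lt_min r0.
rewrite lt_min => /andP[sr sk]; case: ifP => _; first exact: fr.
by rewrite xt fg -xt; exact: gk.
Qed.

(** Lifts are functions on the whole line, clamped outside of the interval, so
    that no partial functions are needed to concatenate them. *)
Lemma lift_exists a b z : a <= b -> p z = c a -> exists f : R -> X,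
  [/\ metric_continuous f, f a = z & forall t, a <= t <= b -> p (f t) = c t].
Proof.
move=> ab; move: z; pose P a b := forall z, p z = c a -> exists f : R -> X,
  [/\ metric_continuous f, f a = z & forall t, a <= t <= b -> p (f t) = c t].
apply: (@interval_creep _ P) => // [s t u /andP[st tu] Pst Ptu z zs|t _].
  have [f [fc fs fp]] := Pst z zs.
  have [|g [gc gt gp]] := Ptu (f t); first by apply: fp; rewrite st lexx.
  exists (fun x => if x <= t then f x else g x); split.
  - exact: metric_continuous_glue.
  - by rewrite st.
  - move=> x /andP[sx xu]; case: leP => xt; first by apply: fp; rewrite sx.
    by apply: gp; rewrite ltW.
have [z zt] := p_surj (c t); have [r [l [r0 lp ld]]] := local_lift zt.
exists r => // s u /andP[_ st] /andP[tu _] sr ur w ws.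
have st' : `|s - t| < r by rewrite ltr_norml; apply/andP; split; lra.
have [phi [phis phid phip]] := deck (etrans (lp s st') (esym ws)).
pose cl x := Num.max s (Num.min x u).
have clr x : `|cl x - t| < r.
  rewrite ltr_norml /cl; case: (leP x u) => h;
    [case: (leP s x)|case: (leP s u)] => h'; apply/andP; split; lra.
have cl1 x y : `|cl x - cl y| <= `|x - y|.
  apply: (@le_trans _ _ `|Num.min x u - Num.min y u|).
    rewrite /cl; move: (Num.min x u) (Num.min y u) => v v'.
    case: (leP s v) => ?; case: (leP s v') => ?; rewrite ?subrr ?normr0 ?normr_ge0 //;
    case: (ger0P (v - v')) => ?; rewrite ler_norml; apply/andP; split; lra.
  case: (leP x u) => ?; case: (leP y u) => ?; rewrite ?subrr ?normr0 ?normr_ge0 //;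
  case: (ger0P (x - y)) => ?; rewrite ler_norml; apply/andP; split; lra.
exists (fun x => phi (l (cl x))); split.
- move=> x e e0; exists e => // y xy; rewrite phid ld //.
  by apply: le_lt_trans (cl1 _ _) _; rewrite distrC.
- by rewrite -phis /cl; congr (phi (l _)); apply/max_idPl; rewrite ge_min; apply/orP;
  left.
- move=> x /andP[sx xu]; rewrite phip lp //; congr c.
  by rewrite /cl min_l // max_r.
Qed.

Section LiftProperties.
Variables (a b : R) (f : R -> X).
Hypothesis f_cont : metric_continuous f.
Hypothesis f_lift : forall t, a <= t <= b -> p (f t) = c t.

(** A continuous lift stays in a ball where [p] is injective, so it coincides
    there with the lift given by nearest points. *)
Lemma lift_isometric t : a <= t <= b -> exists2 e, 0 < e & forall s u,
  a <= s <= b -> a <= u <= b -> `|s - t| < e -> `|u - t| < e -> d (f s) (f u) = `|s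
    - u|.
Proof.
move=> tab; have [e e0 He] := discrete (f t); have [r r0 Hr] := c_geodesic t.
have e4 : 0 < e / 4 by rewrite divr_gt0.
have [k k0 Hk] := f_cont t e4.
exists (Num.min (Num.min k r) (e / 4)) => [|s u sab uab];
  first by rewrite !lt_min k0 r0.
rewrite !lt_min => /andP[/andP[sk sr] se] /andP[/andP[uk ur] ue].
apply/eqP; rewrite eq_le; apply/andP; split; last first.
  by rewrite -(Hr s u) // -f_lift // -[c u]f_lift // quotient_metric_le.
apply/ler_addgt0Pr => n n0; pose m := Num.min n (e / 4).
have m0 : 0 < m by rewrite lt_min n0 divr_gt0.
have mn : m <= n by rewrite ge_min lexx.
have me : m <= e / 4 by rewrite ge_min lexx orbT.
have : quotient_metric (p (f s)) (c u) < `|s - u| + m.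
  by rewrite f_lift // Hr //; lra.
case/quotient_metric_approx => w wu dw.
have su : `|s - u| <= `|s - t| + `|u - t| by rewrite (distrC u); exact: ler_distD.
have := Hk s sk; have := Hk u uk => ? ?.
suff -> : f u = w by lra.
apply: He; first by rewrite f_lift.
  by lra.
by have := d_triangle (f t) (f s) w; lra.
Qed.

Lemma lift_length : a <= b -> d (f a) (f b) <= b - a.
Proof.
move=> ab; pose P a' b' := a <= a' <= b' -> b' <= b -> d (f a') (f b') <= b' - a'.
apply: (@interval_creep _ P); rewrite /P ?lexx ?ab //.
  move=> s t u /andP[st tu] H1 H2 /andP[as_ su] ub.
  have := d_triangle (f s) (f t) (f u).
  have := H1; rewrite as_ st => /(_ isT (le_trans tu ub)).
  by have := H2; rewrite tu (le_trans as_ st) => /(_ isT ub); lra.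
move=> t tab; have [e e0 He] := lift_isometric tab.
exists e => // s u /andP[as_ st] /andP[tu ub] se ue _ _.
rewrite He ?as_ ?ub ?andbT /=; last 4 first.
- exact: le_trans st (le_trans tu ub).
- exact: le_trans as_ (le_trans st tu).
- by rewrite ltr_norml; apply/andP; split; lra.
- by rewrite ltr_norml; apply/andP; split; lra.
by rewrite distrC ger0_norm //; lra.
Qed.

End LiftProperties.

Lemma lift_unique a b f g : a <= b -> metric_continuous f -> metric_continuous g ->
  (forall t, a <= t <= b -> p (f t) = p (g t)) -> f a = g a -> f b = g b.
Proof.
move=> ab fc gc fg; pose P s u := f s = g s -> f u = g u.
apply: (@interval_creep _ P) => // [s t u _ Pst Ptu /Pst/Ptu //|t tab].
have [e e0 He] := discrete (f t); have e2 : 0 < e / 2 by rewrite divr_gt0.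
have [r r0 Hr] := fc t _ e2; have [k k0 Hk] := gc t _ e2.
exists (Num.min r k) => [|s u /andP[as_ st] /andP[tu ub] sr ur];
  first by rewrite lt_min r0.
have near x : t - Num.min r k < x < t + Num.min r k -> `|x - t| < r /\ `|x - t| < k.
  have : Num.min r k <= r by rewrite ge_min lexx.
  have : Num.min r k <= k by rewrite ge_min lexx orbT.
  by move=> ? ? /andP[? ?]; split; rewrite ltr_norml; apply/andP; split; lra.
have [|sr' sk'] := near s; first by rewrite sr /= (le_lt_trans st) // ltrDl lt_min r0.
have [|ur' uk'] := near u; first by rewrite ur andbT (lt_le_trans _ tu) // ltrBlDr
  ltrDl lt_min r0.
rewrite /P => fgs; have fs := Hr s sr'; have gs := Hk s sk'; have fu := Hr u ur';
  have gu := Hk u uk'.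
have fgt : f t = g t.
  apply: He; rewrite ?fg // ?dxx //.
  have := gs; rewrite -fgs dC => gs'.
  by have := d_triangle (f t) (f s) (g t); lra.
apply: He; first by rewrite fg // ub andbT (le_trans _ tu) //; case/andP: tab.
  by lra.
by rewrite fgt; lra.
Qed.

End Lift.

(** * Products of hyperbolic planes *)

Section Topology.
Local Open Scope complex_scope.
Variable R : realType.

Lemma continuous_complex (T : topologicalType) (f : T -> (R[i])^o) :
  continuous (fun t => complex.Re (f t)) -> continuous (fun t => complex.Im (f t)) ->
  continuous f.
Proof.
move=> fr fi t; apply/cvgrPdist_lt => e e0.
have [er ei] : 0 < complex.Re e /\ complex.Im e = 0.
  by move: e0; case: e => a b; rewrite ltcE /= => /andP[/eqP -> ->].
have eE : e = (complex.Re e)%:C by move: ei; case: (e) => a b /= ->.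
have e2 : 0 < complex.Re e / 2 by rewrite divr_gt0.
have /cvgrPdist_lt /(_ _ e2) Hr := fr t.
have /cvgrPdist_lt /(_ _ e2) Hi := fi t.
near=> s; have : `|complex.Re (f t) - complex.Re (f s)| < complex.Re e / 2 by near: s.
have : `|complex.Im (f t) - complex.Im (f s)| < complex.Re e / 2 by near: s.
rewrite {}eE; move: (complex.Re e) er => r r0; case: (f t) => a b;
  case: (f s) => a' b' /=.
move=> h1 h2; rewrite normc_def ltcR /=.
have -> : r = Num.sqrt (r ^+ 2) by rewrite sqrtr_sqr ger0_norm // ltW.
rewrite ltr_sqrt ?exprn_gt0 //.
have sq x : `|x| < r / 2 -> x ^+ 2 < (r / 2) ^+ 2.
  by move=> h; rewrite -[x ^+ 2]real_normK ?num_real // ltrXn2r.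
by have := sq _ h1; have := sq _ h2; have := exprn_gt0 2 r0; nra.
Unshelve. all: by end_near. Qed.

Lemma continuous_H2n (T : topologicalType) (n : nat) (f : T -> H2n R n) :
  (forall i, continuous (fun t => re (f t i))) ->
  (forall i, continuous (fun t => im (f t i))) -> continuous f.
Proof.
move=> fr fi t; apply/cvg_sup => i U [V] [[W] oW <-] /= Wft WU.
move: oW => [Z oZ ZW].
have : continuous (fun t => \val (f t i) : (R[i])^o).
  by apply: continuous_complex; [exact: fr|exact: fi].
move=> /(_ t Z) H.
have Zt : Z (\val (f t i)) by move: Wft; rewrite -ZW.
have /H Ht : nbhs (\val (f t i) : (R[i])^o) Z by exact: open_nbhs_nbhs (conj oZ Zt).
change (nbhs t (f @^-1` U)).
apply: (filterS _ (Ht : nbhs t [set s | Z (\val (f s i))])) => s Zs.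
by apply: WU; rewrite /= -ZW.
Qed.

Lemma cauchy_schwarz (n : nat) (a b : 'I_n -> R) :
  (\sum_i a i * b i) ^+ 2 <= (\sum_i a i ^+ 2) * (\sum_i b i ^+ 2).
Proof.
set A := \sum_i a i ^+ 2; set B := \sum_i b i ^+ 2; set C := \sum_i a i * b i.
have B0 : 0 <= B by apply: sumr_ge0 => i _; exact: sqr_ge0.
have quadratic (x y : R) : \sum_i (a i * x - b i * y) ^+ 2 =
    x ^+ 2 * (\sum_i a i ^+ 2) - 2 * x * y * (\sum_i a i * b i) + y ^+ 2 * (\sum_i b
      i ^+ 2).
  by rewrite !mulr_sumr -sumrB -big_split /=; apply: eq_bigr => i _; ring.
(* The quadratic form evaluated at its minimum, up to scaling. *)
have key : B * (A * B - C ^+ 2) = \sum_i (a i * B - b i * C) ^+ 2.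
  by rewrite quadratic -/A -/B -/C; ring.
have [b0|Bn0] := eqVneq B 0.
  suff -> : C = 0 by rewrite expr0n b0 mulr0.
  apply: big1 => i _; move/eqP: b0; rewrite psumr_eq0; last by move=> j _;
    exact: sqr_ge0.
  by move=> /allP /(_ i (mem_index_enum _)) /=; rewrite sqrf_eq0 => /eqP ->;
    rewrite mulr0.
rewrite -subr_ge0 -(pmulr_rge0 _ (_ : 0 < B)); last by rewrite lt0r Bn0.
by rewrite key; apply: sumr_ge0 => i _; exact: sqr_ge0.
Qed.

Section ProductMetric.
Variable n : nat.
Implicit Types z w m : H2n R n.
Local Notation dist := (@dist_H2n R n).

Lemma dist_H2n_ge0 z w : 0 <= dist z w. Proof. exact: sqrtr_ge0. Qed.

Lemma dist_H2n_sqr z w : dist z w ^+ 2 = \sum_i dist_H2 (z i) (w i) ^+ 2.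
Proof. by rewrite sqr_sqrtr // sumr_ge0 // => i _; exact: sqr_ge0. Qed.

Lemma dist_H2nxx z : dist z z = 0.
Proof.
by rewrite /dist_H2n big1 ?sqrtr0 // => i _; rewrite dist_H2xx expr0n.
Qed.

Lemma dist_H2nC z w : dist z w = dist w z.
Proof. by congr Num.sqrt; apply: eq_bigr => i _; rewrite dist_H2C. Qed.

Lemma dist_H2_le z w i : dist_H2 (z i) (w i) <= dist z w.
Proof.
rewrite -(ler_pXn2r (isT : (0 < 2)%N)) ?nnegrE ?dist_H2_ge0 ?dist_H2n_ge0 //.
rewrite dist_H2n_sqr (bigD1 i) //= lerDl sumr_ge0 // => j _; exact: sqr_ge0.
Qed.

Lemma dist_H2n_triangle z t w : dist z w <= dist z t + dist t w.
Proof.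
rewrite -(ler_pXn2r (isT : (0 < 2)%N)) ?nnegrE ?addr_ge0 ?dist_H2n_ge0 //.
rewrite sqrrD !dist_H2n_sqr.
apply: (@le_trans _ _ (\sum_i (dist_H2 (z i) (t i) + dist_H2 (t i) (w i)) ^+ 2)).
  apply: ler_sum => i _.
  by rewrite ler_pXn2r ?nnegrE ?addr_ge0 ?dist_H2_ge0 // dist_H2_triangle.
under eq_bigr do rewrite sqrrD.
rewrite !big_split /= lerD2r lerD2l -mulr2n lerMn2r /=.
rewrite -(ler_pXn2r (isT : (0 < 2)%N)) ?nnegrE ?mulr_ge0 ?dist_H2n_ge0 ?sumr_ge0 //.
  by rewrite exprMn !dist_H2n_sqr cauchy_schwarz.
by move=> i _; rewrite mulr_ge0 ?dist_H2_ge0.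
Qed.

(** A midpoint in the product is a midpoint in each factor: this is the equality
    case of the parallelogram identity for the vectors of distances. *)
Lemma midpoint_components z m w (h : R) :
  dist z m = h -> dist m w = h -> dist z w = h + h ->
  forall i, dist_H2 (z i) (m i) = dist_H2 (m i) (w i) /\
            dist_H2 (z i) (w i) = dist_H2 (z i) (m i) + dist_H2 (z i) (m i).
Proof.
move=> zm mw zw.
pose a i := dist_H2 (z i) (m i); pose b i := dist_H2 (m i) (w i).
pose e i := dist_H2 (z i) (w i).
have a0 i : 0 <= a i by exact: dist_H2_ge0.
have b0 i : 0 <= b i by exact: dist_H2_ge0.
have e0 i : 0 <= e i by exact: dist_H2_ge0.
have eab i : e i <= a i + b i by exact: dist_H2_triangle.
have A : \sum_i a i ^+ 2 = h ^+ 2 by rewrite -zm dist_H2n_sqr.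
have B : \sum_i b i ^+ 2 = h ^+ 2 by rewrite -mw dist_H2n_sqr.
have E : \sum_i e i ^+ 2 = (h + h) ^+ 2 by rewrite -zw dist_H2n_sqr.
have sq i : 0 <= (a i + b i) ^+ 2 - e i ^+ 2.
  by rewrite subr_ge0 ler_pXn2r ?nnegrE ?addr_ge0.
have : \sum_i ((a i - b i) ^+ 2 + ((a i + b i) ^+ 2 - e i ^+ 2)) = 0.
  transitivity (2 * \sum_i a i ^+ 2 + 2 * \sum_i b i ^+ 2 - \sum_i e i ^+ 2).
    by rewrite !mulr_sumr -big_split /= -sumrB; apply: eq_bigr => i _; ring.
  by rewrite A B E; ring.
move/eqP; rewrite psumr_eq0 => [/allP H i|i _]; last by rewrite addr_ge0 ?sqr_ge0.
move: (H i (mem_index_enum _)) => /=; rewrite paddr_eq0 ?sqr_ge0 // sqrf_eq0 subr_eq0.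
move=> /andP[/eqP ab]; rewrite -/(a i) -/(b i) -/(e i) -ab subr_eq0 => /eqP es.
split=> //; apply/eqP; rewrite -(@eqrXn2 _ 2) ?addr_ge0 //; exact/eqP/esym.
Qed.

Lemma metric_continuous_component (f : R -> H2n R n) i : metric_continuous dist f ->
  metric_continuous (@dist_H2 R) (fun t => f t i).
Proof.
move=> fc t e e0; have [r r0 rP] := fc t e e0; exists r => // s st.
exact: le_lt_trans (dist_H2_le _ _ _) (rP _ st).
Qed.

End ProductMetric.

Lemma metric_continuous_coord (f : R -> @half_plane R) :
  metric_continuous (@dist_H2 R) f ->
  continuous (fun t => re (f t)) /\ continuous (fun t => im (f t)).
Proof.
move=> fc.
have key t (e : R) : 0 < e -> \forall s \near t,
    `|re (f t) - re (f s)| < e /\ `|im (f t) - im (f s)| < e.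
  move=> e0; have [k k0 kP] := dist_H2_coord (f t) e0; have [r r0 rP] := fc t k k0.
  apply/nbhs_ballP; exists r => // s; rewrite /ball /= distrC => ts.
  by apply: kP; exact: rP.
by split=> t; apply/cvgrPdist_lt => e /(key t); apply: filterS => s [].
Qed.

End Topology.

(** * Parabolic isometries have no axis *)

Section NoParabolicAxis.
Variables (R : realType) (n : nat) (f : R -> H2n R n) (i : 'I_n) (g : 'M[R]_2) (L : R).
Hypothesis L0 : 0 < L.
Hypothesis f_cont : metric_continuous (@dist_H2n R n) f.
Hypothesis f_geod : forall t, 0 <= t <= L + L -> exists2 e, 0 < e & forall s u,
  `|s - t| < e -> `|u - t| < e -> dist_H2n (f s) (f u) = `|s - u|.
Hypothesis f_translate : forall t, - L <= t <= L + L -> f (t + L) i = mobius g (f t i).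

(** At a minimum of the height [Y] of the component, [midpoint_height] forces
    the component to be constant nearby, so the set of minima is open and
    closed; but [X] increases by [b] over a period. *)
Lemma no_parabolic_axis : SL2 g -> \tr g = 2 -> g = 1%:M.
Proof.
move=> g1 g2; have [//|gn1] := pselect (g = 1%:M); exfalso.
have [h [b [h1 b0 hP]]] := parabolic_conj g1 g2 gn1.
pose F t := mobius h (f t i); pose X t := re (F t); pose Y t := im (F t).
have XL t : - L <= t <= L + L -> X (t + L) = X t + b.
  by move=> /f_translate; rewrite /X /F => ->; exact: (hP _).1.
have YL t : - L <= t <= L + L -> Y (t + L) = Y t.
  by move=> /f_translate; rewrite /Y /F => ->; exact: (hP _).2.
have Y0 t : 0 < Y t by exact: im_gt0.
have Fc : metric_continuous (@dist_H2 R) F.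
  move=> t e e0; have [r r0 rP] := metric_continuous_component i f_cont t e0.
  by exists r => // s st; rewrite mobius_isometry //; exact: rP.
have Yc : continuous Y by exact: (metric_continuous_coord Fc).2.
have [t0 t0L t0P] : exists2 t0, t0 \in `[0, L] & forall t, t \in `[0, L] -> Y t0 <= Y t.
  by apply: EVT_min; [exact: ltW|exact: continuous_subspaceT].
have {}t0P t : 0 <= t <= L -> Y t0 <= Y t by move=> tL; apply: t0P; rewrite in_itv.
have {t0L}/andP[t00 t0L] : 0 <= t0 <= L by move: t0L; rewrite in_itv.
have Ymin t : - L <= t <= L + L + L -> Y t0 <= Y t.
  move=> /andP[t1 t2].
  have [ta|ta] := ltP t 0.
    by rewrite -(YL t); [apply: t0P|]; apply/andP; split; lra.
  have [tb|tb] := leP t L; first by apply: t0P; rewrite ta.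
  have [tc|tc] := leP t (L + L).
    by rewrite -[t](subrK L) (YL (t - L)); [apply: t0P|]; apply/andP; split; lra.
  rewrite -[t](subrK L) (YL (t - L)); last by apply/andP; split; lra.
  rewrite -[t - L](subrK L) (YL (t - L - L)); last by apply/andP; split; lra.
  by apply: t0P; apply/andP; split; lra.
have const t : 0 <= t <= L + L -> Y t = Y t0 -> exists2 e, 0 < e &
    forall s, `|s - t| < e -> X s = X t /\ Y s = Y t.
  move=> tL Yt; have [e e0 eP] := f_geod tL.
  exists (Num.min e L) => [|s]; first by rewrite lt_min e0.
  rewrite lt_min => /andP[se]; rewrite ltr_norml => /andP[sL1 sL2].
  (* [t] is the midpoint of the geodesic segment from [f s'] to [f s]. *)
  pose s' := t + t - s.
  have s't : `|s' - t| = `|s - t| by rewrite distrC; congr `|_|; rewrite /s'; ring.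
  have s'e : `|s' - t| < e by rewrite s't.
  have [] := @midpoint_components R n (f s') (f t) (f s) `|s - t| _ _ _ i.
  - by rewrite eP ?subrr ?normr0 // s't distrC.
  - by rewrite eP ?subrr ?normr0 // distrC.
  - rewrite eP // (_ : s' - s = (t - s) + (t - s)); last by rewrite /s'; ring.
    by rewrite -mulr2n normrMn distrC mulr2n.
  move=> d1 d2.
  have [] := @midpoint_height R (F s') (F t) (F s).
  - by rewrite /F !mobius_isometry.
  - by rewrite /F !mobius_isometry.
  rewrite -/(X s') -/(X t) -/(X s) -/(Y s') -/(Y t) -/(Y s).
  have Ys' : Y t0 <= Y s' by apply: Ymin; rewrite /s'; apply/andP;
    case/andP: tL => ? ?; split; lra.
  have Ys : Y t0 <= Y s by apply: Ymin; apply/andP; case/andP: tL => ? ?; split; lra.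
  rewrite Yt; have := Y0 t0; move: (Y t0) (Y s) (Y s') Ys Ys' => m y y' my my' m0.
  set q := (X s' - X s) / (y' + y) => e1 e2.
  have y'0 : 0 <= y' by rewrite (le_trans (ltW m0)).
  have y0 : 0 <= y by rewrite (le_trans (ltW m0)).
  have q0 : 0 <= y' * y * q ^+ 2 by apply: mulr_ge0; [exact: mulr_ge0|exact: sqr_ge0].
  have yy : y' * y <= m * m.
    by rewrite -expr2 e1 mulrDr mulr1 lerDl.
  have ym : y = m.
    apply/eqP; rewrite eq_le my andbT -(ler_pM2l m0); apply: le_trans yy.
    by rewrite ler_wpM2r // (le_trans (ltW m0)).
  have ym' : y' = m.
    apply/eqP; rewrite eq_le my' andbT -(ler_pM2r m0); apply: le_trans yy.
    by rewrite ler_wpM2l // (le_trans (ltW m0)).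
  have : m ^+ 2 * q ^+ 2 = 0 by move: e1; rewrite ym ym'; lra.
  move/eqP; rewrite mulf_eq0 !sqrf_eq0 gt_eqF //= /q mulf_eq0 invr_eq0 ym ym'.
  rewrite [_ + m == 0]gt_eqF ?addr_gt0 // orbF subr_eq0 => /eqP xx.
  move: e2; rewrite ym ym' xx => e2; split=> //.
  apply: (mulfI (_ : 1 / m + 1 / m != 0));
    first by rewrite gt_eqF // addr_gt0 ?divr_gt0.
  by rewrite -e2; ring.
pose P s u := X s = X t0 /\ Y s = Y t0 -> X u = X t0 /\ Y u = Y t0.
have : P t0 (t0 + L).
  apply: (@interval_creep _ P); first by rewrite lerDl ltW.
    by move=> s t u _ Ps Pt /Ps/Pt.
  move=> t /andP[t1 t2]; have tL : 0 <= t <= L + L by apply/andP; split; lra.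
  have [Yt|Yt] := eqVneq (Y t) (Y t0).
    have [e e0 eP] := const t tL Yt; exists e => // s u /andP[_ st] /andP[tu _] se ue;
      rewrite /P.
    have [|-> ->] := eP s; first by rewrite ltr_norml; apply/andP; split; lra.
    by have [|-> ->] := eP u; first by rewrite ltr_norml; apply/andP; split; lra.
  have Ytt : 0 < Y t - Y t0.
    by rewrite subr_gt0 lt_neqAle eq_sym Yt Ymin //; apply/andP; case/andP: tL => ? ?;
      split; lra.
  have /cvgrPdist_lt /(_ _ Ytt) /nbhs_ballP [e /= e0 eP] := Yc t.
  exists e => // s u /andP[_ st] /andP[tu _] se ue [_ Ys].
  have : `|Y t - Y s| < Y t - Y t0.
    by apply: eP; rewrite /ball /= ltr_norml; apply/andP; split; lra.
  by rewrite Ys ltNge ler_norm.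
case=> // + _; rewrite XL; last by apply/andP; split; lra.
by move/eqP; rewrite -subr_eq0 addrAC subrr add0r (negbTE b0).
Qed.

End NoParabolicAxis.

(** * The quotient by a congruence subgroup *)

Section Action.
Variables (R : realType) (K : fieldExtType rat) (n : nat).
Variable sigma : 'I_n -> {rmorphism K -> R}.
Local Notation O := (integers K).
Implicit Types (g h : 'M[O]_2) (z w : H2n R n).

Definition place g i : 'M[R]_2 := map_mx (sigma i \o \val) g.

Lemma SL2_place g i : SL2 g -> SL2 (place g i).
Proof. by rewrite /SL2 /= det_map_mx => ->; rewrite rmorph1. Qed.

Lemma place_eq1 g i : place g i = 1%:M -> g = 1%:M.
Proof.
move=> gE; apply/matrixP => a b; apply/val_inj/(fmorph_inj (sigma i)).
have := congr1 (fun m : 'M[R]_2 => m a b) gE; rewrite !mxE => e; apply: (etrans e).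
by rewrite !rmorph_nat.
Qed.

Lemma actM g h z : SL2 g -> SL2 h -> act sigma (g *m h) z = act sigma g (act sigma h z).
Proof.
move=> g1 h1; apply/funext => i; rewrite /act map_mxM mobiusM //; exact: SL2_place.
Qed.

Lemma act1 z : act sigma 1%:M z = z.
Proof. by apply/funext => i; rewrite /act map_mx1 mobius1. Qed.

Lemma act_isometry g z w : SL2 g -> dist_H2n (act sigma g z) (act sigma g w) =
  dist_H2n z w.
Proof.
move=> g1; congr Num.sqrt; apply: eq_bigr => i _.
by rewrite /act mobius_isometry //; exact: SL2_place.
Qed.

Lemma act_adjK g z : SL2 g -> act sigma (\adj g) (act sigma g z) = z.
Proof.
move=> g1; rewrite -actM //; last exact: SL2_adj.
by rewrite mul_adj_mx (g1 : \det g = 1) act1.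
Qed.

Variable I : set O.
Hypothesis Iid : is_ideal I.
Local Notation G := (congruence_subgroup I).
Local Notation proj := (@quot_proj R K n sigma I).

Lemma quot_projP z w : proj z = proj w <-> exists2 g, G g & w = act sigma g z.
Proof.
split.
  move/eqmodP => /asboolP zw.
  have : Defs.orbit sigma I w w.
    by exists 1%:M; [exact: congruence_subgroup1|rewrite act1].
  by rewrite -zw => -[g Gg <-]; exists g.
move=> [g Gg ->]; have [g1 _] := Gg; apply/eqmodP/asboolP/seteqP; split.
  move=> _ [h Gh <-]; have [h1 _] := Gh; exists (h *m \adj g).
    by apply: congruence_subgroupM => //; exact: congruence_subgroup_adj.
  by rewrite actM ?act_adjK //; exact: SL2_adj.
move=> _ [h Gh <-]; have [h1 _] := Gh; exists (h *m g).
  exact: congruence_subgroupM.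
by rewrite actM.
Qed.

Lemma quot_proj_surj q : exists z, proj z = q.
Proof. by exists (repr q); exact: reprK. Qed.

Lemma quot_proj_deck z w : proj z = proj w -> exists phi : H2n R n -> H2n R n,
  [/\ phi z = w, forall u v, dist_H2n (phi u) (phi v) = dist_H2n u v
    & forall u, proj (phi u) = proj u].
Proof.
move=> /quot_projP [g Gg ->]; have [g1 _] := Gg; exists (act sigma g); split=> // u.
- by move=> v; exact: act_isometry.
- by apply/esym/quot_projP; exists g.
Qed.

(** The contraction is the segment to a base point in each half plane; the
    absolute values keep the heights positive also for parameters outside
    [`[0, 1]], so that the homotopy is continuous on the whole plane. *)
Lemma contractible_of_closed_lift (c : R -> quot_space sigma I) (f : R -> H2n R n) (L
  : R) :
  metric_continuous (@dist_H2n R n) f ->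
  (forall t, 0 <= t <= L -> proj (f t) = c t) -> f L = f 0 -> contractible_loop c L.
Proof.
move=> fc fp fL.
have pos (s : R) (z : @half_plane R) : 0 < `|1 - s| * im z + `|s|.
  have [->|s0] := eqVneq s 0.
    by rewrite subr0 normr1 mul1r normr0 addr0 im_gt0.
  by rewrite ltr_wpDl ?normr_gt0 // mulr_ge0 // ltW // im_gt0.
pose H (st : R * R) : H2n R n := fun i =>
  mk_H2 ((1 - st.1) * re (f st.2 i)) (pos st.1 (f st.2 i)).
pose base : H2n R n := fun=> mk_H2 0 (ltr01 : 0 < 1 :> R).
have Hc : continuous H.
  apply: continuous_H2n => i st.
    apply: cvgM; first by apply: cvgB; [exact: cvg_cst|exact: cvg_fst].
    apply: (@continuous_comp _ _ _ snd (fun t => re (f t i))); first exact: cvg_snd.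
    exact: (metric_continuous_coord (metric_continuous_component i fc)).1.
  apply: cvgD; last by apply: cvg_norm; exact: cvg_fst.
  apply: cvgM; first by apply: cvg_norm; apply: cvgB; [exact: cvg_cst|exact: cvg_fst].
  apply: (@continuous_comp _ _ _ snd (fun t => im (f t i))); first exact: cvg_snd.
  exact: (metric_continuous_coord (metric_continuous_component i fc)).2.
exists (proj \o H), (proj base); split.
- apply: continuous_subspaceT => st; apply: continuous_comp; first exact: Hc.
  exact: pi_continuous.
- move=> t; rewrite in_itv => /fp <- /=; congr (proj _); apply/funext => i.
  by apply: H2_eq; rewrite /re /im /= subr0 ?normr1 mul1r // normr0 addr0.
- move=> t _ /=; congr (proj _); apply/funext => i.
  by apply: H2_eq; rewrite /re /im /= subrr ?normr0 mul0r // add0r normr1.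
- by move=> s _ /=; congr (proj _); apply/funext => i; apply: H2_eq;
  rewrite /re /im /= fL.
Qed.

End Action.

(** * Displacement in a congruence subgroup *)

Section Displacement.
Variables (R : realType) (K : fieldExtType rat) (n : nat).
Variable sigma : 'I_n -> {rmorphism K -> R}.
Hypothesis hn : \dim {:K} = n.
Hypothesis sigma_inj : forall i j, sigma i =1 sigma j -> i = j.
Local Notation O := (integers K).

Lemma trace_place (g : 'M[O]_2) i : \tr (place sigma g i) = sigma i (\val (\tr g)).
Proof. by rewrite !mxtrace2E !mxE -rmorphD. Qed.

(** [\tr g - 2] is minus the determinant of [g - 1%:M]. *)
Lemma total_displacement : exists2 C : R, 0 < C &
  forall I : set O, nonzero_ideal I ->
  forall (g : 'M[O]_2) (z : H2n R n), congruence_subgroup I g -> \tr g != 2 ->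
    (ideal_norm I)%:R ^+ 4 <= C * expR (\sum_i dist_H2 (z i) (act sigma g z i)).
Proof.
have [C C0 CP] := embnorm_det_ideal hn sigma_inj.
exists (C ^+ 2 * 16 ^+ n) => [|I Inz g z [g1 gI] t2];
  first by rewrite mulr_gt0 ?exprn_gt0.
have g1E : g 0 0 * g 1 1 - g 0 1 * g 1 0 = 1 by rewrite -det2E.
set u := g - 1%:M in gI.
have uE : u 0 0 * u 1 1 - u 0 1 * u 1 0 = - (\tr g - 2).
  rewrite /u !mxE /= mxtrace2E.
  transitivity (g 0 0 * g 1 1 - g 0 1 * g 1 0 - (g 0 0 + g 1 1) + 1); first by ring.
  by rewrite g1E; ring.
have u0 : u 0 0 * u 1 1 - u 0 1 * u 1 0 != 0 by rewrite uE oppr_eq0 subr_eq0.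
have := CP I Inz _ _ _ _ (gI 0 0) (gI 0 1) (gI 1 0) (gI 1 1) u0.
rewrite uE => h.
have h2 : ((ideal_norm I)%:R ^+ 2) ^+ 2 <= (C * embnorm sigma (\val (- (\tr g - 2))))
  ^+ 2.
  by rewrite lerXn2r ?nnegrE ?exprn_ge0 // mulr_ge0 ?embnorm_ge0 // ltW.
rewrite -exprM in h2; apply: le_trans h2 _.
rewrite exprMn -mulrA ler_wpM2l ?exprn_ge0 ?(ltW C0) //.
rewrite expR_sum -[X in 16 ^+ X]card_ord -prodr_const -big_split /=.
rewrite /embnorm -prodrXl; apply: ler_prod => i _.
rewrite exprn_ge0 //= real_normK ?num_real //.
have -> : sigma i (\val (- (\tr g - 2))) = - (\tr (place sigma g i) - 2).
  have -> : \val (- (\tr g - 2)) = - (\val (\tr g) - 2).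
    by rewrite rmorphN rmorphB rmorph_nat.
  by rewrite trace_place rmorphN rmorphB rmorph_nat.
by rewrite sqrrN trace_displacement //; exact: SL2_place.
Qed.

Lemma large_place (x : O) : x != 0 -> exists i, 1 <= sigma i (\val x) ^+ 2.
Proof.
move=> x0; apply: contrapT => H.
have n0 : (0 < n)%N by rewrite -hn adim_gt0.
have := embnorm_ge1 hn sigma_inj x0; rewrite leNgt => /negP; apply.
apply: (@lt_le_trans _ _ (\prod_(i < n) 1)); last by rewrite prodr_const expr1n.
apply: ltr_prod; first by apply/hasP; exists (Ordinal n0); rewrite ?mem_index_enum.
move=> i _; rewrite normr_ge0 /= ltNge; apply/negP => h; apply: H; exists i.
by rewrite -real_normK ?num_real // exprn_ege1.
Qed.

Variable I : set O.
Hypothesis Iid : is_ideal I.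
(** By [total_displacement], true as soon as the norm of [I] is large. *)
Hypothesis I_large : forall (g : 'M[O]_2) (z : H2n R n), congruence_subgroup I g ->
  \tr g != 2 -> 2 <= expR (\sum_i dist_H2 (z i) (act sigma g z i)).
Local Notation G := (congruence_subgroup I).
Local Notation proj := (@quot_proj R K n sigma I).

(** A nontrivial element of trace 2 has a nonzero entry [c] or, failing this, a
    nonzero entry [b] off the diagonal.  At a place where this entry has
    absolute value at least 1 the displacement is bounded below in terms of
    [im z], by the smaller of the two numbers [kk]. *)
Lemma displacement_bounded_below (z : H2n R n) : exists2 e : R, 0 < e &
  forall g, G g -> dist_H2n z (act sigma g z) < e -> g = 1%:M.
Proof.
have n0 : (0 < n)%N by rewrite -hn adim_gt0.
pose kk i := Num.min (im (z i) ^+ 2 / 2) (1 / (2 * im (z i) ^+ 2)).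
have kk0 i : 0 < kk i.
  by rewrite lt_min !divr_gt0 ?mulr_gt0 ?exprn_gt0 ?im_gt0.
pose k := \big[Num.min/1]_i kk i.
have k0 : 0 < k by apply: lt_bigmin => [|i _]; [exact: ltr01|exact: kk0].
have kle i : k <= kk i by exact: bigmin_le.
have k1 : 1 <= 1 + k by lra.
pose e1 : R := ln 2 / n%:R; pose e2 := arcosh (1 + k).
have e10 : 0 < e1 by rewrite divr_gt0 ?ltr0n // ln_gt0 // ltr1n.
have e20 : 0 < e2.
  rewrite lt0r arcosh_ge0 // andbT; apply: contraTneq k0 => k0.
  by have := arcoshK k1; rewrite -/e2 k0 /cosh oppr0 expR0; lra.
exists (Num.min e1 e2) => [|g Gg]; first by rewrite lt_min e10.
rewrite lt_min => /andP[d1 d2]; have [g1 _] := Gg.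
have t2 : \tr g = 2.
  apply/eqP/negPn/negP => t2; have := I_large z Gg t2.
  rewrite leNgt => /negP; apply.
  rewrite -[ltRHS]lnK ?posrE // ltr_expR.
  apply: (@le_lt_trans _ _ (\sum_(i < n) dist_H2n z (act sigma g z))).
    by apply: ler_sum => i _; exact: dist_H2_le.
  by rewrite sumr_const card_ord -[ltLHS]mulr_natr -ltr_pdivlMr // ltr0n.
have t2i i : \tr (place sigma g i) = 2 by rewrite trace_place t2 !rmorph_nat.
have small i : coshd (z i) (mobius (place sigma g i) (z i)) - 1 < k.
  have : dist_H2 (z i) (act sigma g z i) < e2 by exact: le_lt_trans (dist_H2_le _ _
    _) d2.
  move/(ltr_cosh (dist_H2_ge0 _ _)); rewrite cosh_dist arcoshK //.
  by rewrite /act -/(place sigma g i); lra.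
have gi i : SL2 (place sigma g i) by exact: SL2_place.
have c0 : g 1 0 = 0.
  apply/eqP/negPn/negP => /large_place [i ci].
  have := parabolic_displacement (z i) (gi i) (t2i i); rewrite leNgt => /negP; apply.
  apply: lt_le_trans (small i) _; apply: le_trans (kle i) _.
  rewrite ge_min; apply/orP; left; rewrite ler_pM2r ?invr_gt0 // ler_peMl ?sqr_ge0 //.
  by rewrite mxE.
have b0 : g 0 1 = 0.
  apply/eqP/negPn/negP => /large_place [i bi].
  have ci : place sigma g i 1 0 = 0 by rewrite mxE /= c0 !rmorph0.
  have := small i; rewrite upper_displacement // ltNge => /negP; apply.
  apply: le_trans (kle i) _; rewrite ge_min; apply/orP; right.
  by rewrite ler_pM2r ?invr_gt0 ?mulr_gt0 ?exprn_gt0 ?im_gt0 // mxE.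
pose i := Ordinal n0.
have ci : place sigma g i 1 0 = 0 by rewrite mxE /= c0 !rmorph0.
have bi : place sigma g i 0 1 = 0 by rewrite mxE /= b0 !rmorph0.
have [ai di] := unipotent_upper (gi i) (t2i i) ci.
apply: (place_eq1 (sigma := sigma) (i := i)); apply/matrixP.
by apply: forall_ord2; apply: forall_ord2; rewrite ?ai ?bi ?ci ?di mxE.
Qed.

Lemma quot_proj_discrete (z : H2n R n) : exists2 e : R, 0 < e &
  forall w w', proj w = proj w' -> dist_H2n z w < e -> dist_H2n z w' < e -> w = w'.
Proof.
have [e e0 eP] := displacement_bounded_below z.
exists (e / 2) => [|w w' /(quot_projP sigma Iid) [g Gg ->] zw zw'];
  first by rewrite divr_gt0.
suff -> : g = 1%:M by rewrite act1.
apply: eP => //; have [g1 _] := Gg.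
apply: le_lt_trans (dist_H2n_triangle _ (act sigma g w) _) _.
by rewrite act_isometry // dist_H2nC [dist_H2n w z]dist_H2nC dist_H2nC; lra.
Qed.

(** The lift is taken on [-L, 3 * L], so that the interval [0, 2 * L], where a
    minimum of the height and its translate are found, is in its interior. *)
Lemma closed_geodesic_displacement (c : R -> quot_space sigma I) (L : R) :
  closed_geodesic (@quot_dist R K n sigma I) c L -> ~ contractible_loop c L ->
  exists (g : 'M[O]_2) (z : H2n R n),
    [/\ G g, \tr g != 2 & dist_H2n z (act sigma g z) <= L].
Proof.
move=> [L0 cL cgeo] ncontr.
have n0 : (0 < n)%N by rewrite -hn adim_gt0.
have [z zc] := @quot_proj_surj R K n sigma I (c (- L)).
have Lab : - L <= L + L + L by lra.
have [f [fc _ fp]] := lift_exists (@dist_H2n_ge0 R n) (@dist_H2n_triangle R n)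
  (@quot_proj_surj R K n sigma I) (quot_proj_deck Iid) quot_proj_discrete cgeo Lab zc.
have projL t : - L <= t <= L + L -> proj (f (t + L)) = proj (f t).
  by move=> tL; rewrite !fp ?cL //; apply/andP; split; lra.
have [|g Gg f0] := (quot_projP sigma Iid (f (- L)) (f 0)).1.
  by rewrite -projL ?addNr //; apply/andP; split; lra.
have [g1 _] := Gg.
have fL t : - L <= t <= L + L -> f (t + L) = act sigma g (f t).
  move=> /andP[t1 t2]; apply: (@lift_unique _ _ _ _ proj (@dist_H2nxx R n)
    (@dist_H2nC R n)
    (@dist_H2n_triangle R n) quot_proj_discrete (- L) t (fun t => f (t + L)) (fun t
      => act sigma g (f t))) => //.
  - move=> s e e0; have [r r0 rP] := fc (s + L) e e0; exists r => // u us.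
    by apply: rP; rewrite opprD addrACA subrr addr0.
  - by move=> s e /(fc s)[r r0 rP]; exists r => // u /rP; rewrite act_isometry.
  - move=> s /andP[s1 s2]; rewrite projL; last by apply/andP; split; lra.
    by apply/quot_projP => //; exists g.
  - by rewrite addNr.
have fiso t : - L <= t <= L + L + L -> exists2 e : R, 0 < e & forall s u,
    - L <= s <= L + L + L -> - L <= u <= L + L + L ->
    `|s - t| < e -> `|u - t| < e -> dist_H2n (f s) (f u) = `|s - u|.
  exact: (lift_isometric (@dist_H2n_ge0 R n) (@dist_H2n_triangle R n)
  (@quot_proj_surj R K n sigma I) (quot_proj_deck Iid) quot_proj_discrete cgeo fc fp).
have f0L : f L = act sigma g (f 0) by rewrite -fL ?add0r //; apply/andP; split; lra.
have [t2|t2] := eqVneq (\tr g) 2; last first.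
  exists g, (f 0); split=> //; rewrite -f0L -[leRHS]subr0.
  apply: (lift_length (@dist_H2n_ge0 R n) (@dist_H2n_triangle R n)
    (@quot_proj_surj R K n sigma I) (quot_proj_deck Iid) quot_proj_discrete cgeo fc)
      => //.
    by move=> t /andP[? ?]; apply: fp; apply/andP; split; lra.
  exact: ltW.
exfalso; apply: ncontr.
suff g1E : g = 1%:M.
  apply: (contractible_of_closed_lift fc); last by rewrite f0L g1E act1.
  by move=> t /andP[? ?]; apply: fp; apply/andP; split; lra.
pose i := Ordinal n0.
apply: (place_eq1 (sigma := sigma) (i := i)).
apply: (@no_parabolic_axis R n f i _ L) => //.
- move=> t /andP[t1 t3].
  have [|e e0 eP] := fiso t; first by apply/andP; split; lra.
  exists (Num.min e L) => [|s u]; first by rewrite lt_min e0.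
  rewrite !lt_min !ltr_norml.
  move=> /andP[/andP[s1 s2] /andP[s3 s4]] /andP[/andP[u1 u2] /andP[u3 u4]].
  by apply: eP; rewrite ?ltr_norml; apply/andP; split; lra.
- by move=> t /fL ->.
- exact: SL2_place.
- by rewrite trace_place t2 !rmorph_nat.
Qed.
End Displacement.

Lemma sum_le_dist_H2n (R : realType) (n : nat) (z w : H2n R n) :
  \sum_i dist_H2 (z i) (w i) <= Num.sqrt n%:R * dist_H2n z w.
Proof.
rewrite -(ler_pXn2r (isT : (0 < 2)%N)) ?nnegrE ?mulr_ge0 ?dist_H2n_ge0 ?sqrtr_ge0 //;
  last by apply: sumr_ge0 => i _; exact: dist_H2_ge0.
rewrite exprMn sqr_sqrtr // dist_H2n_sqr mulrC.
have := cauchy_schwarz (fun i => dist_H2 (z i) (w i)) (fun=> 1).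
under eq_bigr do rewrite mulr1.
by rewrite expr1n sumr_const card_ord.
Qed.

Unset Implicit Arguments.
Set Strict Implicit.


Theorem theorem5p1 (R : realType) (K : fieldExtType rat) (n : nat)
    (sigma : 'I_n -> {rmorphism K -> R})
    (hn : \dim {:K} = n) (hK : totally_real R K)
    (hsigma : real_embeddings sigma) :
  exists c : R, forall I : nat -> set (integers K),
    (forall k, nonzero_ideal (I k)) ->
    (fun k => ideal_norm (I k)) @ \oo --> \oo ->
    \forall k \near \oo,
      ((4 / (3 * Num.sqrt n%:R)
          * ln (group_index (@SL2 (integers K)) (congruence_subgroup (I k)))%:R
        - c)%:E
       <= systole (@quot_dist R K n sigma (I k)))%E.
Proof.
have [sigma_inj _] := hsigma.
have n0 : (0 < n)%N by rewrite -hn adim_gt0.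
pose r : R := Num.sqrt n%:R; have r0 : 0 < r by rewrite sqrtr_gt0 ltr0n.
have [C C0 CP] := total_displacement hn sigma_inj.
exists (ln C / r) => I Inz /cvgnyPge /(_ (Num.truncn (2 * C)).+1) large.
apply: filterS large => k; set N := ideal_norm (I k) => NC.
have N1 : 1 <= N%:R :> R by rewrite ler1n (leq_trans _ NC).
have NC4 : 2 * C <= N%:R ^+ 4.
  apply: le_trans (ltW (truncnS_gt _)) _; apply: le_trans (_ : N%:R <= _).
    by rewrite ler_nat.
  by rewrite -[leLHS]expr1 ler_weXn2l.
have Iid : is_ideal (I k) by case: (Inz k).
have I_large (g : 'M[integers K]_2) (z : H2n R n) : congruence_subgroup (I k) g ->
    \tr g != 2 -> 2 <= expR (\sum_i dist_H2 (z i) (act sigma g z i)).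
  move=> Gg t2; rewrite -(ler_pM2l C0) mulrC; apply: le_trans NC4 _.
  exact: CP (Inz k) g z Gg t2.
apply: le_ereal_inf_tmp => _ [L [c cgeo ncontr] <-]; rewrite lee_fin.
have [g [z [Gg t2 zL]]] := closed_geodesic_displacement hn sigma_inj Iid I_large cgeo
  ncontr.
have sumL := le_trans (sum_le_dist_H2n z (act sigma g z)) (ler_wpM2l (ltW r0) zL).
have N0 : 0 < N%:R :> R by exact: lt_le_trans N1.
have Nn0 : (0 < N)%N by rewrite -(ltr0n R).
have : 4 * ln N%:R <= ln C + r * L.
  have := CP (I k) (Inz k) g z Gg t2; rewrite -/N => h.
  have : ln (N%:R ^+ 4) <= ln (C * expR (\sum_i dist_H2 (z i) (act sigma g z i))).
    by rewrite ler_ln ?posrE ?exprn_gt0 // mulr_gt0 ?expR_gt0.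
  rewrite lnXn // lnM ?posrE ?expR_gt0 // expRK mulr_natl => h'.
  by apply: le_trans h' _; rewrite lerD2l.
pose x : R := ln (group_index (@SL2 (integers K)) (congruence_subgroup (I k)))%:R.
have : x <= 3 * ln N%:R.
  have := group_index_le Iid Nn0.
  rewrite /x -/N; case: (group_index _ _) => [_|m mN];
    first by rewrite ln0 // mulr_ge0 // ln_ge0.
  rewrite mulr_natl -lnXn // ler_ln ?posrE ?exprn_gt0 ?ltr0n //.
  by rewrite -natrX ler_nat.
move=> h1 h2; rewrite -/x.
rewrite -/r -(ler_pM2l r0).
have -> : r * (4 / (3 * r) * x - ln C / r) = 4 / 3 * x - ln C by field; rewrite gt_eqF.
by lra.
Qed.
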